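(* Let $a>0$ and let $k$ be a non-negative integer. Define \[J_{2k+1}(a)=\int_0^\infty\frac{x\,e^{-\pi a x^2}}{e^{2\pi x}-1}\,{}_1F_1\!\left(-2k-1;\tfrac{3}{2};2\pi a x^2\right)dx .\] Then \[J_{2k+1}(a)=-T_{2k+1}(a)+\epsilon_{2k+1}(a),\] where \[T_{2k+1}(a)=\frac{1}{4\pi a}\left\{\left(\frac{1-a^{1/2}}{2}\right)\sqrt{\frac{\pi}{2}}\,\frac{\Gamma(2k+2)}{\Gamma(2k+\frac{5}{2})}+{}_2F_1\!\left(-2k-1,1;\tfrac{3}{2};2\right)\right\}\] and \[\epsilon_{2k+1}(a)=\frac{1}{4\pi a}\int_1^\infty \{a^{1/2}\phi(t)-\psi(t)\}\,\frac{(t-1)^{2k+1}}{(1+t)^{2k+5/2}}\,dt,\] with $\psi(t)=\sum_{n\ge1}e^{-\pi n^2 t/a}$ and $\phi(t)=\sum_{n\ge1}e^{-\pi n^2 a t}$.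
   Context: ${}_1F_1$ denotes Kummer's confluent hypergeometric function and ${}_2F_1$ the Gauss hypergeometric function; for negative integer first parameter both series terminate. *)

(* Defs.v *)
From Stdlib Require Import Reals Lra.
From Coquelicot Require Import Coquelicot.
Open Scope R_scope.

Fixpoint poch (x : R) (j : nat) : R :=
  match j with
  | O => 1
  | S j' => poch x j' * (x + INR j')
  end.

(* Kummer's 1F1(-m; b; z) for a non-positive integer first parameter -m:
   the series terminates after the term j = m. *)
Definition hyp1F1_neg (m : nat) (b z : R) : R :=
  sum_f_R0 (fun j => poch (- INR m) j / poch b j * z ^ j / INR (Factorial.fact j)) m.

(* Gauss 2F1(-m, c; b; z) for a non-positive integer first parameter -m
   (terminating series). *)
Definition hyp2F1_neg (m : nat) (c b z : R) : R :=
  sum_f_R0 (fun j => poch (- INR m) j * poch c j / poch b j * z ^ j / INR (Factorial.fact j)) m.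

Definition Gamma (s : R) : R :=
  RInt_gen (fun t => Rpower t (s - 1) * exp (- t)) (at_point 0) (Rbar_locally p_infty).

Definition psi_theta (a t : R) : R :=
  Series (fun n => exp (- PI * (INR n + 1) ^ 2 * t / a)).
Definition phi_theta (a t : R) : R :=
  Series (fun n => exp (- PI * (INR n + 1) ^ 2 * a * t)).

Definition J_integrand (k : nat) (a x : R) : R :=
  x * exp (- PI * a * x ^ 2) / (exp (2 * PI * x) - 1)
    * hyp1F1_neg (2 * k + 1) (3 / 2) (2 * PI * a * x ^ 2).

Definition T_val (k : nat) (a : R) : R :=
  / (4 * PI * a) *
  ((1 - sqrt a) / 2 * sqrt (PI / 2) * (Gamma (2 * INR k + 2) / Gamma (2 * INR k + 5 / 2))
   + hyp2F1_neg (2 * k + 1) 1 (3 / 2) 2).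

Definition eps_integrand (k : nat) (a t : R) : R :=
  (sqrt a * phi_theta a t - psi_theta a t)
  * (t - 1) ^ (2 * k + 1) / Rpower (1 + t) (2 * INR k + 5 / 2).

(* Main.v *)
Require Import Defs.
From Stdlib Require Import Reals Lra Lia Psatz Factorial ZArith.
From Coquelicot Require Import Coquelicot.
Open Scope R_scope.
Set Bullet Behavior "Strict Subproofs".

(* Put m = 2k+1. Expanding 1/(exp (2 pi x) - 1) as a geometric series turns J into a
   sum of Laplace transforms at 2 pi n of x exp(-pi a x^2) 1F1(-m; 3/2; 2 pi a x^2).
   Integration by parts gives the same recurrences for the odd moments of
   exp(-p x^2 - b x) and for the integrals of exp(-c t) t^j / (1+t)^(j+3/2), c = b^2/(4p),
   so each Laplace transform equals 1/(4 pi a) times the integral over [0,oo) of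
   exp(-pi n^2 t/a) (1-t)^m / (1+t)^(m+3/2).
   Folding (0,1) onto (1,oo) by t -> 1/t (m is odd) and summing over n gives
     4 pi a J = int_1^oo (psi(1/t) / sqrt t - psi(t)) (t-1)^m / (1+t)^(m+3/2) dt,
   and the theta transformation 1 + 2 psi(1/t) = sqrt(a t) (1 + 2 phi(t)) replaces
   psi(1/t) by phi(t); the elementary terms that appear are Beta integrals, which make up T.
   The theta transformation itself is proved by Polya's argument: the sum of
   cos^(2m) over the n-th roots of unity samples the binomial distribution at the
   multiples of n, and one lets n -> oo with m ~ s n^2. *)

(** * Improper integrals on a half-line and the Gaussian integral *)

(** Exchanging sum and integral is the delicate point, on both sides. Near x = 0 each term x exp(-2
    pi n x) vanishes while their sum tends to 1/(2 pi), so the geometric expansion is not uniformly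
    convergent there. The exact remainder of the geometric series is kept instead, and only its
    integral, of order 1/N, has to vanish. In the variable t, the sum of exp(-pi n^2 t/a) blows up
    like t^(-1/2) at t = 0. For this reason each Laplace transform is folded onto (1,oo) separately,
    before summing: with c = pi n^2/a the folded kernel is bounded by 2 c^(-3/4) t^(-5/4), which is
    summable in n and integrable in t.

    Half-integral powers are written with [sqrt]: once the root is generalised to a variable s with
    1 + t = s^2, every derivative identity is rational and [field] closes it. *)

Definition is_RInt_inf (f : R -> R) (a l : R) : Prop :=
  (forall b, a <= b -> ex_RInt f a b) /\ is_lim (RInt f a) p_infty l.

(** The final statement uses [is_RInt_gen]; the work is done with [is_RInt_inf], where sums,
    comparisons and limits reduce to [is_lim] of a function of the upper bound. *)
Lemma is_RInt_inf_gen f a l :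
  is_RInt_inf f a l -> is_RInt_gen f (at_point a) (Rbar_locally p_infty) l.
Proof.
intros [Hex Hl] P HP.
assert (Hl' : filterlim (RInt f a) (Rbar_locally p_infty) (locally l)) by exact Hl.
destruct (Hl' P HP) as [M HM].
apply (Filter_prod _ _ _ (fun x => x = a) (fun y => Rmax M a < y)).
- reflexivity.
- now exists (Rmax M a).
- intros x y -> Hy. exists (RInt f a y). split.
  + apply (@RInt_correct R_CompleteNormedModule).
    apply Hex. generalize (Rmax_r M a). simpl. lra.
  + apply HM. generalize (Rmax_l M a). lra.
Qed.

Lemma is_RInt_inf_ext f g a l :
  (forall x, a < x -> f x = g x) -> is_RInt_inf f a l -> is_RInt_inf g a l.
Proof.
intros Hfg [Hex Hl].
assert (E : forall b, a <= b -> forall x, Rmin a b < x < Rmax a b -> f x = g x).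
{ intros b Hb x. rewrite Rmin_left, Rmax_right by lra. intros. apply Hfg; lra. }
split.
- intros b Hb. apply (ex_RInt_ext f); [apply E | apply Hex]; lra.
- apply (is_lim_ext_loc (RInt f a)); [|exact Hl].
  exists a. intros b Hb. apply RInt_ext, E. lra.
Qed.

Lemma is_RInt_inf_lim (f F : R -> R) (a l : R) :
  (forall b, a <= b -> is_RInt f a b (F b)) -> is_lim F p_infty l -> is_RInt_inf f a l.
Proof.
intros HF Hl. split.
- intros b Hb. exists (F b). now apply HF.
- apply (is_lim_ext_loc F); [|exact Hl].
  exists a. intros b Hb. symmetry. apply is_RInt_unique, HF. lra.
Qed.

Lemma is_RInt_inf_derive (f F : R -> R) (a l : R) :
  (forall x, a <= x -> is_derive F x (f x)) ->
  (forall x, a <= x -> continuous f x) ->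
  is_lim F p_infty l -> is_RInt_inf f a (l - F a).
Proof.
intros HF Hc Hl. apply (is_RInt_inf_lim f (fun b => F b - F a)).
- intros b Hb. apply (is_RInt_derive F f a b);
    intros x; rewrite Rmin_left by lra; intros [Hx _]; auto.
- apply is_lim_minus'; [exact Hl | apply is_lim_const].
Qed.

Lemma is_RInt_inf_plus f g a lf lg :
  is_RInt_inf f a lf -> is_RInt_inf g a lg ->
  is_RInt_inf (fun x => f x + g x) a (lf + lg).
Proof.
intros [Hf Lf] [Hg Lg].
apply (is_RInt_inf_lim _ (fun b => RInt f a b + RInt g a b)).
- intros b Hb. apply (is_RInt_plus f g); apply (@RInt_correct R_CompleteNormedModule); auto.
- now apply is_lim_plus'.
Qed.

Lemma is_RInt_inf_scal f a k l :
  is_RInt_inf f a l -> is_RInt_inf (fun x => k * f x) a (k * l).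
Proof.
intros [Hf Lf].
apply (is_RInt_inf_lim _ (fun b => k * RInt f a b)).
- intros b Hb. apply (is_RInt_scal f a b k); apply (@RInt_correct R_CompleteNormedModule); auto.
- apply (is_lim_scal_l _ k _ _ Lf).
Qed.

Lemma is_RInt_inf_sum (f : nat -> R -> R) (a : R) (l : nat -> R) (n : nat) :
  (forall j, (j <= n)%nat -> is_RInt_inf (f j) a (l j)) ->
  is_RInt_inf (fun x => sum_f_R0 (fun j => f j x) n) a (sum_f_R0 l n).
Proof.
induction n as [|n IH]; intros H.
- apply H. lia.
- simpl. apply is_RInt_inf_plus; [apply IH; intros; apply H|apply H]; lia.
Qed.

Lemma is_RInt_inf_le_bound f a l b :
  (forall x, a < x -> 0 <= f x) -> is_RInt_inf f a l -> a <= b -> RInt f a b <= l.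
Proof.
intros Hpos [Hex Hl] Hb.
apply (is_lim_le_loc (fun _ => RInt f a b) (RInt f a) p_infty (RInt f a b) l);
  [|apply is_lim_const|exact Hl].
exists b. intros c Hc.
rewrite <- (RInt_Chasles f a b c).
- assert (0 <= RInt f b c); [|unfold plus; simpl; lra].
  apply RInt_ge_0; [lra| |intros; apply Hpos; lra].
  apply (ex_RInt_Chasles_2 f a b c); [lra | apply Hex; lra].
- now apply Hex.
- apply (ex_RInt_Chasles_2 f a b c); [lra | apply Hex; lra].
Qed.

(* No uniform convergence on [a, +oo) is needed: the error is only controlled in mean. *)
Lemma is_RInt_inf_approx (f : R -> R) (a : R) (S G : nat -> R -> R) (I e : nat -> R) :
  (forall b, a <= b -> ex_RInt f a b) ->
  (forall N, is_RInt_inf (S N) a (I N)) ->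
  (forall N, is_RInt_inf (G N) a (e N)) ->
  (forall N x, a < x -> Rabs (f x - S N x) <= G N x) ->
  is_lim_seq e 0 ->
  exists l : R, is_lim_seq I l /\ is_RInt_inf f a l.
Proof.
intros Hf HS HG Hle He.
assert (Gpos : forall N x, a < x -> 0 <= G N x).
{ intros N x Hx. generalize (Rabs_pos (f x - S N x)), (Hle N x Hx). lra. }
assert (D : forall N b, a <= b -> Rabs (RInt f a b - RInt (S N) a b) <= e N).
{ intros N b Hb.
  assert (Hd : ex_RInt (fun x => f x - S N x) a b).
  { apply (ex_RInt_minus f (S N)); [now apply Hf | now apply (HS N)]. }
  replace (RInt f a b - RInt (S N) a b) with (RInt (fun x => f x - S N x) a b).
  2:{ apply (RInt_minus f (S N)); [now apply Hf | now apply (HS N)]. }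
  apply Rle_trans with (RInt (G N) a b).
  - apply Rle_trans with (RInt (fun x => Rabs (f x - S N x)) a b).
    + now apply abs_RInt_le.
    + apply RInt_le; [exact Hb| | now apply (HG N) | intros; apply Hle; lra].
      apply (ex_RInt_norm (fun x => f x - S N x)); exact Hd.
  - apply is_RInt_inf_le_bound; auto. }
(* The bound of [D] is uniform in the upper limit [b], so it survives [b] to infinity. This makes
   [I] a Cauchy sequence before convergence of the integral of [f] is known. *)
assert (DI : forall N M, Rabs (I N - I M) <= e N + e M).
{ intros N M.
  assert (L : is_lim (fun b => Rabs (RInt (S N) a b - RInt (S M) a b)) p_infty (Rabs (I N - I M))).
  { apply (is_lim_Rabs (fun b => RInt (S N) a b - RInt (S M) a b) p_infty (I N - I M)).
    apply is_lim_minus'; [apply (HS N) | apply (HS M)]. }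
  apply (is_lim_le_loc (fun b => Rabs (RInt (S N) a b - RInt (S M) a b)) (fun _ => e N + e M)
           p_infty (Rabs (I N - I M)) (e N + e M)); [|exact L|apply is_lim_const].
  exists a. intros b Hb.
  generalize (D N b (Rlt_le _ _ Hb)), (D M b (Rlt_le _ _ Hb)).
  unfold Rabs; repeat destruct Rcase_abs; lra. }
assert (Cau : ex_finite_lim_seq I).
{ apply ex_lim_seq_cauchy_corr. intros eps.
  apply is_lim_seq_spec in He. destruct (He (pos_div_2 eps)) as [N0 HN0].
  exists N0. intros n m Hn Hm. eapply Rle_lt_trans; [apply DI|].
  generalize (HN0 n Hn), (HN0 m Hm). rewrite !Rminus_0_r. simpl.
  unfold Rabs; repeat destruct Rcase_abs; lra. }
destruct Cau as [l Hl]. exists l. split; [exact Hl|]. split; [exact Hf|].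
assert (Dl : forall N, Rabs (I N - l) <= e N).
{ intros N.
  apply (is_lim_seq_le (fun M => Rabs (I N - I M)) (fun M => e N + e M)
           (Rabs (I N - l)) (e N)).
  - intros M. apply DI.
  - apply (is_lim_seq_abs (fun M => I N - I M) (Finite (I N - l))).
    apply is_lim_seq_minus'; [apply is_lim_seq_const | exact Hl].
  - replace (Finite (e N)) with (Finite (e N + 0)) by (f_equal; ring).
    apply is_lim_seq_plus'; [apply is_lim_seq_const | exact He]. }
apply is_lim_spec. intros eps.
apply is_lim_seq_spec in He. destruct (He (mkposreal _ (is_pos_div_2 (pos_div_2 eps)))) as [N0 HN0].
destruct (HS N0) as [_ L]. apply is_lim_spec in L. destruct (L (pos_div_2 eps)) as [M HM].
exists (Rmax a M). intros b Hb.
assert (a < b /\ M < b) as [Hab HMb].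
{ generalize (Rmax_l a M), (Rmax_r a M). lra. }
generalize (D N0 b (Rlt_le _ _ Hab)), (Dl N0), (HM b HMb), (HN0 N0 (Nat.le_refl _)).
rewrite Rminus_0_r. simpl.
unfold Rabs; repeat destruct Rcase_abs; lra.
Qed.

Lemma ex_RInt_cont (f : R -> R) a b :
  (forall x, a <= x <= b -> continuous f x) -> a <= b -> ex_RInt f a b.
Proof.
intros H Hab. apply (@ex_RInt_continuous R_CompleteNormedModule).
intros x. rewrite Rmin_left, Rmax_right by lra. auto.
Qed.

Ltac continuous_auto := apply (@ex_derive_continuous R_AbsRing R_NormedModule); auto_derive; try nra; auto.

Definition gauss_prim (x : R) : R := RInt (fun u => exp (- u ^ 2)) 0 x.

Lemma continuous_gauss x : continuous (fun u => exp (- u ^ 2)) x.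
Proof. continuous_auto. Qed.

Lemma is_derive_gauss_prim x : is_derive gauss_prim x (exp (- x ^ 2)).
Proof.
apply (is_derive_RInt (fun u => exp (- u ^ 2)) gauss_prim 0 x).
- apply filter_forall. intros b. apply (@RInt_correct R_CompleteNormedModule).
  apply (@ex_RInt_continuous R_CompleteNormedModule). intros; apply continuous_gauss.
- apply continuous_gauss.
Qed.

(* Differentiating in x, the sum of [gauss_prim x ^ 2] and of this parametric integral is constant. *)
Definition gauss_param (x : R) : R := RInt (fun t => exp (- x ^ 2 * (1 + t ^ 2)) / (1 + t ^ 2)) 0 1.

Lemma is_derive_gauss_param x : is_derive gauss_param x (- 2 * exp (- x ^ 2) * gauss_prim x).
Proof.
assert (Hpos : forall t, 1 + t ^ 2 <> 0) by (intros t; nra).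
set (f := fun x t => exp (- x ^ 2 * (1 + t ^ 2)) / (1 + t ^ 2)).
assert (Df : forall u t, is_derive (fun z => f z t) u (- 2 * u * exp (- u ^ 2 * (1 + t ^ 2)))).
{ intros u t. unfold f. auto_derive; [exact I | simpl; field; nra]. }
replace (- 2 * exp (- x ^ 2) * gauss_prim x) with (RInt (fun t => Derive (fun u => f u t) x) 0 1).
- apply (is_derive_RInt_param f 0 1 x).
  + apply filter_forall. intros u t _. exists (- 2 * u * exp (- u ^ 2 * (1 + t ^ 2))). apply Df.
  + intros t _.
    apply (continuity_2d_pt_ext (fun u v => - 2 * u * exp (- u ^ 2 * (1 + v ^ 2)))).
    { intros u v. symmetry. apply is_derive_unique, Df. }
    assert (C2 : continuity_2d_pt (fun u v => u ^ 2 * (1 + v ^ 2)) x t).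
    { apply continuity_2d_pt_mult.
      - apply (continuity_2d_pt_ext (fun u v => u * u)); [intros; simpl; ring|].
        apply continuity_2d_pt_mult; apply continuity_2d_pt_id1.
      - apply continuity_2d_pt_plus; [apply continuity_2d_pt_const|].
        apply (continuity_2d_pt_ext (fun u v => v * v)); [intros; simpl; ring|].
        apply continuity_2d_pt_mult; apply continuity_2d_pt_id2. }
    apply continuity_2d_pt_mult.
    * apply continuity_2d_pt_mult; [apply continuity_2d_pt_const | apply continuity_2d_pt_id1].
    * apply (continuity_2d_pt_ext (fun u v => exp (- (u ^ 2 * (1 + v ^ 2)))));
        [intros; f_equal; ring|].
      apply (continuity_1d_2d_pt_comp exp).
      -- apply derivable_continuous_pt, derivable_pt_exp.
      -- now apply continuity_2d_pt_opp.
  + apply filter_forall. intros u. apply ex_RInt_cont; [|lra].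
    intros t _. unfold f. continuous_auto.
(* Once exp(-x^2) is factored out, u = x t carries [0,1] to [0,x]; the [+ 0] provides the affine
   shape that [RInt_comp_lin] matches. *)
- transitivity (RInt (fun t => - 2 * exp (- x ^ 2) * (x * exp (- (x * t + 0) ^ 2))) 0 1).
  + apply RInt_ext. intros t _. etransitivity; [apply is_derive_unique, Df|].
    replace (- x ^ 2 * (1 + t ^ 2)) with (- x ^ 2 + - (x * t + 0) ^ 2) by ring.
    rewrite exp_plus. simpl. ring.
  + transitivity (scal (- 2 * exp (- x ^ 2)) (RInt (fun t => x * exp (- (x * t + 0) ^ 2)) 0 1)).
    * apply (RInt_scal (fun t => x * exp (- (x * t + 0) ^ 2))).
      apply ex_RInt_cont; [|lra]. intros t _. continuous_auto.
    * unfold scal; simpl; unfold mult; simpl. f_equal.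
      etransitivity; [apply (RInt_comp_lin (fun u => exp (- u ^ 2)) x 0 0 1)|].
      { apply (@ex_RInt_continuous R_CompleteNormedModule). intros; apply continuous_gauss. }
      unfold gauss_prim. f_equal; ring.
Qed.

Lemma gauss_param_0 : gauss_param 0 = PI / 4.
Proof.
unfold gauss_param. apply is_RInt_unique.
apply (is_RInt_ext (fun t => / (1 + t ^ 2))).
{ intros t _. replace (- 0 ^ 2 * (1 + t ^ 2)) with 0 by ring. rewrite exp_0. symmetry. apply Rmult_1_l. }
replace (PI / 4) with (minus (atan 1) (atan 0)).
2:{ unfold minus, plus, opp; simpl. rewrite atan_1, atan_0. ring. }
apply (is_RInt_derive atan).
- intros x _. apply is_derive_Reals. apply derivable_pt_lim_atan.
- intros x _. continuous_auto.
Qed.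

Lemma gauss_identity x : gauss_prim x ^ 2 + gauss_param x = PI / 4.
Proof.
assert (D : forall u, is_derive (fun v => gauss_prim v ^ 2 + gauss_param v) u 0).
{ intros u.
  replace 0 with (INR 2 * exp (- u ^ 2) * gauss_prim u ^ pred 2 + (- 2 * exp (- u ^ 2) * gauss_prim u))
    by (simpl; ring).
  apply (is_derive_plus (fun v => gauss_prim v ^ 2) gauss_param).
  - apply is_derive_pow, is_derive_gauss_prim.
  - apply is_derive_gauss_param. }
rewrite <- gauss_param_0.
assert (E0 : gauss_prim 0 = 0) by (unfold gauss_prim; apply (@RInt_point R_CompleteNormedModule)).
replace (gauss_param 0) with (gauss_prim 0 ^ 2 + gauss_param 0) by (rewrite E0; ring).
destruct (MVT_gen (fun v => gauss_prim v ^ 2 + gauss_param v) 0 x (fun _ => 0)) as [c [_ Hc]].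
- intros u _. apply D.
- intros u _. apply continuity_pt_filterlim.
  apply (ex_derive_continuous (fun v => gauss_prim v ^ 2 + gauss_param v)). exists 0. apply D.
- lra.
Qed.

Lemma is_lim_exp_neg_lin (c : R) : 0 < c -> is_lim (fun x => exp (- (c * x))) p_infty 0.
Proof.
intros Hc. apply (is_lim_comp exp (fun x => - (c * x)) p_infty 0 m_infty).
- apply is_lim_exp_m.
- apply (is_lim_opp _ _ p_infty).
  replace p_infty with (Rbar_mult c p_infty) at 2.
  + apply (is_lim_scal_l (fun x => x)), is_lim_id.
  + simpl. destruct Rle_dec; [|lra]. destruct Rle_lt_or_eq_dec; [reflexivity | lra].
- exists 0. discriminate.
Qed.

(** By [gauss_identity] it suffices that [gauss_param] vanishes at infinity, and for x > 1 its
    integrand is at most exp(-x). *)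
Lemma is_lim_gauss_prim : is_lim gauss_prim p_infty (sqrt PI / 2).
Proof.
assert (L : is_lim gauss_param p_infty 0).
{ apply (is_lim_le_le_loc (fun _ => 0) (fun x => exp (- (1 * x)))).
  - exists 1. intros x Hx. unfold gauss_param.
    assert (Hc : forall t, 0 <= t <= 1 ->
      continuous (fun t => exp (- x ^ 2 * (1 + t ^ 2)) / (1 + t ^ 2)) t) by (intros; continuous_auto).
    split.
    + apply RInt_ge_0; [lra | apply ex_RInt_cont; [exact Hc | lra] |].
      intros t _. apply Rlt_le, Rdiv_lt_0_compat; [apply exp_pos | nra].
    + replace (exp (- (1 * x))) with (RInt (fun _ => exp (- (1 * x))) 0 1).
      2:{ rewrite RInt_const. unfold scal; simpl; unfold mult; simpl. ring. }
      apply RInt_le; [lra | apply ex_RInt_cont; [exact Hc | lra] | apply ex_RInt_const |].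
      intros t Ht. apply Rle_trans with (exp (- x ^ 2 * (1 + t ^ 2)) / 1).
      * apply Rmult_le_compat_l; [apply Rlt_le, exp_pos|]. apply Rinv_le_contravar; nra.
      * rewrite Rdiv_1_r. destruct (Req_dec (- x ^ 2 * (1 + t ^ 2)) (- (1 * x))) as [->|Hne];
          [lra|]. apply Rlt_le, exp_increasing. nra.
  - apply is_lim_const.
  - apply is_lim_exp_neg_lin. lra. }
apply (is_lim_ext_loc (fun x => sqrt (PI / 4 - gauss_param x))).
- exists 0. intros x Hx. rewrite <- (gauss_identity x).
  replace (gauss_prim x ^ 2 + gauss_param x - gauss_param x) with (gauss_prim x ^ 2) by ring.
  apply sqrt_pow2. apply RInt_ge_0; [lra| |intros; apply Rlt_le, exp_pos].
  apply (@ex_RInt_continuous R_CompleteNormedModule). intros; apply continuous_gauss.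
- replace (sqrt PI / 2) with (sqrt (PI / 4 - 0)).
  2:{ rewrite Rminus_0_r, sqrt_div_alt by lra. replace 4 with (2 * 2) by ring.
      rewrite sqrt_square; lra. }
  apply (is_lim_comp_continuous (fun x => PI / 4 - gauss_param x) sqrt).
  + apply is_lim_minus'; [apply is_lim_const | exact L].
  + apply continuity_pt_filterlim, continuity_pt_sqrt. generalize PI_RGT_0. lra.
Qed.

(** * Laplace transforms of Gaussian moments *)

Lemma pow_le_exp n x : 0 <= x -> x ^ n <= INR (fact n) * exp x.
Proof.
intros Hx.
assert (Hf : 0 < INR (fact n)) by apply INR_fact_lt_0.
assert (H : x ^ n / INR (fact n) <= exp x).
{ apply Rle_trans with (2 := exp_ge_taylor x n Hx).
  destruct n as [|n]; [simpl; lra|].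
  rewrite tech5.
  assert (0 <= sum_f_R0 (fun k => x ^ k / INR (fact k)) n).
  { apply cond_pos_sum. intros k. apply Rdiv_le_0_compat; [now apply pow_le | apply INR_fact_lt_0]. }
  lra. }
apply Rmult_le_compat_l with (r := INR (fact n)) in H; [|lra].
replace (INR (fact n) * (x ^ n / INR (fact n))) with (x ^ n) in H by (field; lra).
exact H.
Qed.

Lemma is_lim_pow_exp k c : 0 < c -> is_lim (fun x => x ^ k * exp (- (c * x))) p_infty 0.
Proof.
intros Hc.
set (K := INR (fact (S k)) / c ^ (S k)).
assert (HcS : 0 < c ^ S k) by now apply pow_lt.
apply (is_lim_le_le_loc (fun _ => 0) (fun x => K * / x)).
- exists 0. intros x Hx. split.
  + apply Rmult_le_pos; [apply pow_le; lra | apply Rlt_le, exp_pos].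
  + assert (H := pow_le_exp (S k) (c * x)).
    rewrite Rpow_mult_distr in H.
    rewrite exp_Ropp. unfold K.
    assert (He := exp_pos (c * x)).
    apply Rmult_le_reg_r with (c ^ S k * x * exp (c * x)).
    { apply Rmult_lt_0_compat; nra. }
    replace (x ^ k * / exp (c * x) * (c ^ S k * x * exp (c * x))) with (c ^ S k * x ^ S k)
      by (simpl; field; lra).
    replace (INR (fact (S k)) / c ^ S k * / x * (c ^ S k * x * exp (c * x)))
      with (INR (fact (S k)) * exp (c * x)) by (field; lra).
    apply H. nra.
- apply is_lim_const.
- replace (Finite 0) with (Rbar_mult (Finite K) (Rbar_inv p_infty)) by (simpl; f_equal; ring).
  apply (is_lim_scal_l (fun x => / x)). apply is_lim_inv; [apply is_lim_id | discriminate].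
Qed.

Definition gmom (p b : R) (k : nat) (x : R) : R := x ^ k * exp (- (p * x ^ 2 + b * x)).

Lemma is_lim_gmom p b k : 0 < p -> 0 <= b -> is_lim (gmom p b k) p_infty 0.
Proof.
intros Hp Hb.
apply (is_lim_le_le_loc (fun _ => 0) (fun x => x ^ k * exp (- (p * x)))).
- exists 1. intros x Hx. unfold gmom.
  assert (0 <= x ^ k) by (apply pow_le; lra). split.
  + apply Rmult_le_pos; [assumption | apply Rlt_le, exp_pos].
  + apply Rmult_le_compat_l; [assumption|].
    assert (p * x <= p * x ^ 2 + b * x).
    { assert (0 <= p * (x * (x - 1))) by (repeat apply Rmult_le_pos; lra).
      assert (0 <= b * x) by (apply Rmult_le_pos; lra). simpl. lra. }
    destruct (Req_dec (p * x) (p * x ^ 2 + b * x)) as [->|]; [lra|].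
    apply Rlt_le, exp_increasing. lra.
- apply is_lim_const.
- now apply is_lim_pow_exp.
Qed.

Lemma continuous_gmom p b k x : continuous (gmom p b k) x.
Proof. unfold gmom. continuous_auto. Qed.

(** The denominator is (1 + t)^(j + 3/2). These kernels play the role of the odd Gaussian moments on
    the other side of the Laplace transform. *)
Definition nmom (c : R) (j : nat) (t : R) : R :=
  exp (- (c * t)) * t ^ j / ((1 + t) ^ (S j) * sqrt (1 + t)).

Lemma is_lim_nmom c j : 0 < c -> is_lim (nmom c j) p_infty 0.
Proof.
intros Hc.
apply (is_lim_le_le_loc (fun _ => 0) (fun x => exp (- (c * x)))).
- exists 0. intros x Hx. unfold nmom.
  assert (0 <= x ^ j) by (apply pow_le; lra).
  assert (x ^ j <= (1 + x) ^ j) by (apply pow_incr; lra).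
  assert (1 <= sqrt (1 + x)) by (rewrite <- sqrt_1 at 1; apply sqrt_le_1; lra).
  assert (0 < (1 + x) ^ j) by (apply pow_lt; lra).
  assert (He := exp_pos (- (c * x))).
  assert (Hd : (1 + x) ^ j <= (1 + x) ^ S j * sqrt (1 + x)).
  { simpl. replace ((1 + x) ^ j) with ((1 + x) ^ j * (1 * 1)) at 1 by ring.
    replace ((1 + x) * (1 + x) ^ j * sqrt (1 + x)) with ((1 + x) ^ j * ((1 + x) * sqrt (1 + x))) by ring.
    apply Rmult_le_compat_l; [lra|]. apply Rmult_le_compat; lra. }
  split.
  + apply Rdiv_le_0_compat; [apply Rmult_le_pos; lra | lra].
  + apply Rmult_le_reg_r with ((1 + x) ^ S j * sqrt (1 + x)); [lra|].
    unfold Rdiv. rewrite Rmult_assoc, Rinv_l, Rmult_1_r by lra.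
    apply Rmult_le_compat_l; lra.
- apply is_lim_const.
- now apply is_lim_exp_neg_lin.
Qed.

Lemma continuous_nmom c j t : 0 <= t -> continuous (nmom c j) t.
Proof.
intros Ht. unfold nmom.
assert (0 < (1 + t) ^ S j) by (apply pow_lt; lra).
assert (0 < sqrt (1 + t)) by (apply sqrt_lt_R0; lra).
apply (@ex_derive_continuous R_AbsRing R_NormedModule). auto_derive.
simpl in H. repeat split; try lra. simpl. apply Rgt_not_eq. apply Rmult_lt_0_compat; lra.
Qed.

(** Differentiating one Gaussian monomial mixes odd and even powers. The coefficients of [Q] are
    chosen so that x^(2k+4) and x^(2k+2) cancel in its derivative [dQ]; since [Q] vanishes at both
    ends, integrating [dQ] relates three consecutive odd moments. *)
Lemma gmom_rec p b k u v : 0 < p -> 0 <= b ->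
  is_RInt_inf (gmom p b (2 * k + 1)) 0 u -> is_RInt_inf (gmom p b (2 * k + 3)) 0 v ->
  is_RInt_inf (gmom p b (2 * k + 5)) 0
    (((2 * p * (4 * INR k + 7) + b ^ 2) * v - (2 * INR k + 3) * (2 * INR k + 2) * u) / (4 * p ^ 2)).
Proof.
intros Hp Hb Hu Hv.
set (Q := fun x => 2 * p * gmom p b (2 * k + 4) x - b * gmom p b (2 * k + 3) x
                   - (2 * INR k + 3) * gmom p b (2 * k + 2) x).
set (dQ := fun x => (2 * p * (4 * INR k + 7) + b ^ 2) * gmom p b (2 * k + 3) x
    - 4 * p ^ 2 * gmom p b (2 * k + 5) x
    - (2 * INR k + 3) * (2 * INR k + 2) * gmom p b (2 * k + 1) x).
assert (H : is_RInt_inf dQ 0 (0 - Q 0)).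
{ apply is_RInt_inf_derive.
  - intros x _. unfold Q, dQ, gmom.
    assert (Hn : INR k = INR (2 * k) / 2) by (rewrite mult_INR; simpl; field).
    rewrite Hn. clear Hn. generalize (2 * k)%nat. intros n.
    rewrite !Nat.add_succ_r, Nat.add_0_r.
    auto_derive; [exact I|].
    change (match n with 0%nat => 1 | S _ => INR n + 1 end) with (INR (S n)).
    rewrite S_INR. simpl pow.
    replace (p * (x * (x * 1)) + b * x) with (p * x ^ 2 + b * x) by ring.
    field.
  - intros x _. unfold dQ, gmom. continuous_auto.
  - unfold Q. replace (Finite 0) with (Finite (2 * p * 0 - b * 0 - (2 * INR k + 3) * 0)) by (f_equal; ring).
    repeat apply is_lim_minus';
    match goal with |- is_lim (fun x => ?c * gmom p b ?n x) _ _ =>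
      apply (is_lim_scal_l (gmom p b n) c p_infty 0) end; now apply is_lim_gmom. }
assert (Q0 : Q 0 = 0).
{ unfold Q, gmom. rewrite !pow_i by lia. ring. }
rewrite Q0 in H.
eapply is_RInt_inf_ext;
  [|replace (_ / _) with (- / (4 * p ^ 2) * (0 - 0) + ((2 * p * (4 * INR k + 7) + b ^ 2) / (4 * p ^ 2) * v
      + - ((2 * INR k + 3) * (2 * INR k + 2) / (4 * p ^ 2)) * u)) by (field; lra);
    apply is_RInt_inf_plus; [|apply is_RInt_inf_plus]; apply is_RInt_inf_scal; eassumption].
intros x _. unfold dQ. field. lra.
Qed.

(** Differentiation produces t^j/(1 + t)^(j + 5/2), which is no [nmom] kernel. Because 1 = (1 + t) -
    t, it is the difference of the kernels of index j and j + 1 (exponential factor aside), and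
    likewise one index higher. *)
Lemma nmom_deriv c j t : 0 <= t ->
  is_derive (nmom c (S j)) t (- (c + 2 * INR j + 7 / 2) * nmom c (S j) t
     + (INR j + 1) * nmom c j t + (INR j + 5 / 2) * nmom c (S (S j)) t).
Proof.
intros Ht.
assert (Hp : 0 < (1 + t) ^ j) by (apply pow_lt; lra).
assert (Hs : 0 < sqrt (1 + t)) by (apply sqrt_lt_R0; lra).
assert (Hss : 1 + t = sqrt (1 + t) ^ 2) by (simpl; rewrite Rmult_1_r, sqrt_sqrt; lra).
unfold nmom. auto_derive.
- repeat split; try lra. simpl. apply Rgt_not_eq. repeat apply Rmult_lt_0_compat; lra.
- change (match j with 0%nat => 1 | S _ => INR j + 1 end) with (INR (S j)).
  rewrite S_INR. simpl pow.
  revert Hp Hss. generalize (sqrt (1 + t)) Hs. intros s Hs' _ Hss.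
  assert (Ht' : t = s ^ 2 - 1) by lra.
  assert (Hp : 0 < (1 + t) ^ j) by (apply pow_lt; lra).
  assert (Hp' : 0 < 1 + t) by lra.
  revert Hp Hp'. generalize ((1 + t) ^ j). intros w Hw. generalize (t ^ j). intros y.
  subst t. replace (1 + (s ^ 2 - 1)) with (s ^ 2) by ring. intros _.
  field. lra.
Qed.

Lemma nmom_rec c j u v : 0 < c ->
  is_RInt_inf (nmom c j) 0 u -> is_RInt_inf (nmom c (S j)) 0 v ->
  is_RInt_inf (nmom c (S (S j))) 0
    (((c + 2 * INR j + 7 / 2) * v - (INR j + 1) * u) / (INR j + 5 / 2)).
Proof.
intros Hc Hu Hv.
assert (Hj := pos_INR j).
set (dQ := fun t => - (c + 2 * INR j + 7 / 2) * nmom c (S j) t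
     + (INR j + 1) * nmom c j t + (INR j + 5 / 2) * nmom c (S (S j)) t).
assert (H : is_RInt_inf dQ 0 (0 - nmom c (S j) 0)).
{ apply is_RInt_inf_derive.
  - apply nmom_deriv.
  - intros x Hx. unfold dQ.
    apply (continuous_plus (fun t => - (c + 2 * INR j + 7 / 2) * nmom c (S j) t
     + (INR j + 1) * nmom c j t) (fun t => (INR j + 5 / 2) * nmom c (S (S j)) t));
     [apply (continuous_plus (fun t => - (c + 2 * INR j + 7 / 2) * nmom c (S j) t)
       (fun t => (INR j + 1) * nmom c j t))|];
    match goal with |- continuous (fun x => ?k * nmom c ?n x) _ =>
      apply (continuous_scal_r k (nmom c n)) end; now apply continuous_nmom.
  - now apply is_lim_nmom. }
assert (Q0 : nmom c (S j) 0 = 0) by (unfold nmom; rewrite (pow_i (S j)) by lia; unfold Rdiv; ring).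
rewrite Q0 in H.
eapply is_RInt_inf_ext;
  [|replace (_ / _) with (/ (INR j + 5 / 2) * (0 - 0) + ((c + 2 * INR j + 7 / 2) / (INR j + 5 / 2) * v
      + - ((INR j + 1) / (INR j + 5 / 2)) * u)) by (field; lra);
    apply is_RInt_inf_plus; [|apply is_RInt_inf_plus]; apply is_RInt_inf_scal; eassumption].
intros x _. unfold dQ. field. lra.
Qed.

Lemma is_lim_gauss_prim_affine (f : R -> R) :
  is_lim f p_infty p_infty -> is_lim (fun x => gauss_prim (f x)) p_infty (sqrt PI / 2).
Proof.
intros Hf. apply (is_lim_comp gauss_prim f p_infty _ p_infty is_lim_gauss_prim Hf).
exists 0. discriminate.
Qed.

(** With p = s^2 and b = 2 g s one has c = g^2. Completing squares, p x^2 + b x = (s x + g)^2 - g^2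
    and g^2 t = (g sqrt(1 + t))^2 - g^2, so both integrands have explicit primitives in terms of
    [gauss_prim]. *)
Lemma gmom_nmom_base p b : 0 < p -> 0 < b ->
  exists u, is_RInt_inf (nmom (b ^ 2 / (4 * p)) 0) 0 u /\
    is_RInt_inf (gmom p b 1) 0 (u / (4 * p)).
Proof.
intros Hp Hb.
set (s := sqrt p). assert (Hs : 0 < s) by now apply sqrt_lt_R0.
assert (Hps : p = s ^ 2) by (unfold s; simpl; rewrite Rmult_1_r, sqrt_sqrt; lra).
clearbody s. subst p.
set (g := b / (2 * s)). assert (Hg : 0 < g) by (apply Rdiv_lt_0_compat; lra).
assert (Hbg : b = 2 * g * s) by (unfold g; field; lra).
clearbody g. subst b.
replace ((2 * g * s) ^ 2 / (4 * s ^ 2)) with (g ^ 2) by (field; lra).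
(* The limit at infinity minus the value at 0 of the primitive [F] of the first bullet. *)
exists (- 0 - 4 * g * exp (g ^ 2) * (sqrt PI / 2) - (- 2 - 4 * g * exp (g ^ 2) * gauss_prim g)).
split.
- set (F := fun t => - 2 * exp (- (g ^ 2 * t)) * / sqrt (1 + t) - 4 * g * exp (g ^ 2) * gauss_prim (g * sqrt (1 + t))).
  replace (- 2 - 4 * g * exp (g ^ 2) * gauss_prim g) with (F 0).
  2:{ unfold F. rewrite Rplus_0_r, sqrt_1, Rmult_1_r, Rmult_0_r, Ropp_0, exp_0. field. }
  apply is_RInt_inf_derive.
  + intros t Ht. unfold F, nmom.
    assert (Hq : 0 < sqrt (1 + t)) by (apply sqrt_lt_R0; lra).
    assert (Hss : 1 + t = sqrt (1 + t) ^ 2) by (simpl; rewrite Rmult_1_r, sqrt_sqrt; lra).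
    auto_derive.
    * repeat split; try lra. exists (exp (- (g * sqrt (1 + t)) ^ 2)). apply is_derive_gauss_prim.
    * rewrite (is_derive_unique gauss_prim _ _ (is_derive_gauss_prim _)).
      replace (- (g * sqrt (1 + t)) ^ 2) with (- (g ^ 2 * t) + - g ^ 2).
      2:{ rewrite Rpow_mult_distr, <- Hss. ring. }
      rewrite exp_plus, (exp_Ropp (g ^ 2)).
      replace (g * (g * 1)) with (g ^ 2) by ring.
      generalize (exp_pos (g ^ 2)). generalize (exp (g ^ 2)), (exp (- (g ^ 2 * t))).
      intros e1 e2 He1. simpl pow.
      revert Hq Hss. generalize (sqrt (1 + t)). intros q Hq Hss.
      replace (1 + t) with (q ^ 2) by lra. field. lra.
  + intros x Hx. apply continuous_nmom. lra.
  + apply is_lim_minus'.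
    * replace (Finite (- 0)) with (Finite 0) by (f_equal; ring).
      apply (is_lim_le_le_loc (fun t => - 2 * exp (- (g ^ 2 * t))) (fun _ => 0)).
      -- exists 0. intros t Ht.
         assert (1 <= sqrt (1 + t)) by (rewrite <- sqrt_1 at 1; apply sqrt_le_1; lra).
         assert (He := exp_pos (- (g ^ 2 * t))).
         assert (0 < / sqrt (1 + t) <= 1).
         { split; [apply Rinv_0_lt_compat; lra|]. apply Rmult_le_reg_l with (sqrt (1 + t)); [lra|]. rewrite Rinv_r; lra. }
         split; nra.
      -- replace (Finite 0) with (Finite (- 2 * 0)) by (f_equal; ring).
         apply (is_lim_scal_l _ (-2) p_infty 0). apply is_lim_exp_neg_lin. nra.
      -- apply is_lim_const.
    * apply (is_lim_scal_l (fun t => gauss_prim (g * sqrt (1 + t))) _ p_infty (sqrt PI / 2)).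
      apply is_lim_gauss_prim_affine.
      apply (is_lim_le_p_loc (fun t => g * sqrt t)).
      -- exists 0. intros t Ht. apply Rmult_le_compat_l; [lra|]. apply sqrt_le_1; lra.
      -- replace p_infty with (Rbar_mult g p_infty) at 2.
         ++ apply (is_lim_scal_l sqrt g p_infty p_infty). apply filterlim_sqrt_p.
         ++ simpl. destruct Rle_dec; [|lra]. destruct Rle_lt_or_eq_dec; [reflexivity | lra].
- set (F := fun x => - / (2 * s ^ 2) * gmom (s ^ 2) (2 * g * s) 0 x
                     - g / s ^ 2 * exp (g ^ 2) * gauss_prim (s * x + g)).
  replace ((_ - _) / _) with (- / (2 * s ^ 2) * 0 - g / s ^ 2 * exp (g ^ 2) * (sqrt PI / 2) - F 0).
  2:{ unfold F, gmom. replace (s * 0 + g) with g by ring.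
      replace (- (s ^ 2 * 0 ^ 2 + 2 * g * s * 0)) with 0 by ring. rewrite exp_0. simpl (0 ^ 0). field. lra. }
  apply is_RInt_inf_derive.
  + intros x Hx. unfold F, gmom. auto_derive.
    * repeat split. exists (exp (- (s * x + g) ^ 2)). apply is_derive_gauss_prim.
    * rewrite (is_derive_unique gauss_prim _ _ (is_derive_gauss_prim _)).
      replace (- (s * x + g) ^ 2) with (- (s ^ 2 * x ^ 2 + 2 * g * s * x) + - g ^ 2) by ring.
      rewrite exp_plus, (exp_Ropp (g ^ 2)).
      replace (s * (s * 1) * (x * (x * 1)) + 2 * g * s * x) with (s ^ 2 * x ^ 2 + 2 * g * s * x) by ring.
      replace (g * (g * 1)) with (g ^ 2) by ring.
      generalize (exp (g ^ 2)) (exp_pos (g ^ 2)). intros. simpl pow. field. lra.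
  + intros; apply continuous_gmom.
  + apply is_lim_minus'.
    * apply (is_lim_scal_l (gmom (s ^ 2) (2 * g * s) 0) _ p_infty 0). apply is_lim_gmom; nra.
    * apply (is_lim_scal_l (fun t => gauss_prim (s * t + g)) _ p_infty (sqrt PI / 2)).
      apply is_lim_gauss_prim_affine.
      apply (is_lim_le_p_loc (fun t => s * t)); [exists 0; intros; lra|].
      replace p_infty with (Rbar_mult s p_infty) at 2.
      -- apply (is_lim_scal_l (fun t => t) s p_infty p_infty). apply is_lim_id.
      -- simpl. destruct Rle_dec; [|lra]. destruct Rle_lt_or_eq_dec; [reflexivity | lra].
Qed.

Lemma poch_pos x j : 0 < x -> 0 < poch x j.
Proof.
intros Hx. induction j as [|j IH]; simpl; [lra|].
apply Rmult_lt_0_compat; [exact IH | generalize (pos_INR j); lra].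
Qed.

(** Since b^2 = 4 p c, scaling by [poch (3 / 2) j / (4 * p ^ S j)] turns [nmom_rec] into [gmom_rec].
    The recurrences have order two, so the induction carries two consecutive indices. *)
Lemma gmom_nmom p b j : 0 < p -> 0 < b ->
  exists u, is_RInt_inf (nmom (b ^ 2 / (4 * p)) j) 0 u /\
    is_RInt_inf (gmom p b (2 * j + 1)) 0 (poch (3 / 2) j * u / (4 * p ^ S j)).
Proof.
intros Hp Hb. set (c := b ^ 2 / (4 * p)).
assert (Hc : 0 < c) by (apply Rdiv_lt_0_compat; nra).
assert (Hbc : b ^ 2 = 4 * p * c) by (unfold c; field; lra).
assert (P : exists u v, (is_RInt_inf (nmom c j) 0 u /\
    is_RInt_inf (gmom p b (2 * j + 1)) 0 (poch (3 / 2) j * u / (4 * p ^ S j))) /\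
  is_RInt_inf (nmom c (S j)) 0 v /\
    is_RInt_inf (gmom p b (2 * j + 3)) 0 (poch (3 / 2) (S j) * v / (4 * p ^ S (S j)))).
2:{ destruct P as [u [v [H _]]]. now exists u. }
induction j as [|j IH].
- destruct (gmom_nmom_base p b Hp Hb) as [u [Hu Hu']]. fold c in Hu.
  (* Index 1 comes from a relation with a constant term: [nmom c 0] and [gmom p b 0] both equal 1 at
     0, so the boundary contribution does not vanish and this step is not an instance of the general
     recurrences. *)
  exists u, ((c + 3 / 2) * u / (3 / 2) - / (3 / 2)). split; split.
  + exact Hu.
  + simpl. replace (1 * u / (4 * (p * 1))) with (u / (4 * p)) by (field; lra). exact Hu'.
  + assert (H : is_RInt_inf (fun t => - (c + 3 / 2) * nmom c 0 t + 3 / 2 * nmom c 1 t) 0 (0 - nmom c 0 0)).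
    { apply is_RInt_inf_derive.
      - intros t Ht.
        assert (Hs : 0 < sqrt (1 + t)) by (apply sqrt_lt_R0; lra).
        assert (Hss : 1 + t = sqrt (1 + t) ^ 2) by (simpl; rewrite Rmult_1_r, sqrt_sqrt; lra).
        unfold nmom. auto_derive.
        + repeat split; try lra. simpl. apply Rgt_not_eq. repeat apply Rmult_lt_0_compat; lra.
        + simpl pow. revert Hs Hss. generalize (sqrt (1 + t)). intros s Hs Hss.
          assert (Ht' : t = s ^ 2 - 1) by lra. subst t.
          replace (1 + (s ^ 2 - 1)) with (s ^ 2) by ring. field. lra.
      - intros t Ht.
        apply (continuous_plus (fun t => - (c + 3 / 2) * nmom c 0 t) (fun t => 3 / 2 * nmom c 1 t));
        match goal with |- continuous (fun x => ?k * nmom c ?n x) _ =>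
          apply (continuous_scal_r k (nmom c n)) end; now apply continuous_nmom.
      - now apply is_lim_nmom. }
    assert (Q0 : nmom c 0 0 = 1).
    { unfold nmom. rewrite Rmult_0_r, Ropp_0, exp_0, Rplus_0_r, sqrt_1. simpl. field. }
    rewrite Q0 in H.
    eapply is_RInt_inf_ext;
    [|replace (_ - _) with (/ (3 / 2) * (0 - 1) + (c + 3 / 2) / (3 / 2) * u) by field;
      apply is_RInt_inf_plus; apply is_RInt_inf_scal; eassumption].
    intros x _. simpl. field.
  + assert (H : is_RInt_inf (fun t => (6 * p + b ^ 2) * gmom p b 1 t - 4 * p ^ 2 * gmom p b 3 t) 0
        (2 * p * 0 - b * 0 - 0 - (2 * p * gmom p b 2 0 - b * gmom p b 1 0 - gmom p b 0 0))).
    { apply (is_RInt_inf_derive _ (fun x => 2 * p * gmom p b 2 x - b * gmom p b 1 x - gmom p b 0 x)).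
      - intros x _. unfold gmom. auto_derive; [exact I|]. simpl pow.
        replace (p * (x * (x * 1)) + b * x) with (p * x ^ 2 + b * x) by ring. field.
      - intros x _. unfold gmom. continuous_auto.
      - repeat apply is_lim_minus';
        try match goal with |- is_lim (fun x => ?c * gmom p b ?n x) _ _ =>
          apply (is_lim_scal_l (gmom p b n) c p_infty 0) end; apply is_lim_gmom; lra. }
    replace (2 * p * 0 - b * 0 - 0 - (2 * p * gmom p b 2 0 - b * gmom p b 1 0 - gmom p b 0 0)) with 1 in H.
    2:{ unfold gmom. replace (- (p * 0 ^ 2 + b * 0)) with 0 by ring. rewrite exp_0. simpl. ring. }
    eapply is_RInt_inf_ext;
    [|replace (_ / _) with ((6 * p + b ^ 2) / (4 * p ^ 2) * (u / (4 * p)) + - / (4 * p ^ 2) * 1)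
        by (rewrite Hbc; simpl; field; lra);
      apply is_RInt_inf_plus; apply is_RInt_inf_scal; eassumption].
    intros x _. simpl. field. lra.
- destruct IH as [u [v [[Hu Hu'] [Hv Hv']]]].
  assert (Hj := pos_INR j). assert (Hpj : 0 < p ^ j) by now apply pow_lt.
  exists v, (((c + 2 * INR j + 7 / 2) * v - (INR j + 1) * u) / (INR j + 5 / 2)). split; split.
  + exact Hv.
  + replace (2 * S j + 1)%nat with (2 * j + 3)%nat by lia. exact Hv'.
  + now apply nmom_rec.
  + replace (2 * S j + 3)%nat with (2 * j + 5)%nat by lia.
    replace (_ / _) with (((2 * p * (4 * INR j + 7) + b ^ 2) * (poch (3 / 2) (S j) * v / (4 * p ^ S (S j)))
      - (2 * INR j + 3) * (2 * INR j + 2) * (poch (3 / 2) j * u / (4 * p ^ S j))) / (4 * p ^ 2)).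
    * apply gmom_rec; lra || assumption.
    * rewrite Hbc.
      change (poch (3 / 2) (S (S j))) with (poch (3 / 2) j * (3 / 2 + INR j) * (3 / 2 + INR (S j))).
      change (poch (3 / 2) (S j)) with (poch (3 / 2) j * (3 / 2 + INR j)).
      rewrite S_INR. simpl pow. field. lra.
Qed.

(** * Kummer polynomials and finite Beta integrals *)

Lemma is_RInt_inf_RInt_gen f a l :
  is_RInt_inf f a l -> RInt_gen f (at_point a) (Rbar_locally p_infty) = l.
Proof.
intros H. apply (@is_RInt_gen_unique R_CompleteNormedModule).
- apply Proper_StrongProper, at_point_filter.
- apply Proper_StrongProper, Rbar_locally_filter.
- now apply is_RInt_inf_gen.
Qed.

Lemma poch_neg m j : (j <= m)%nat ->
  poch (- INR m) j / INR (fact j) = (-1) ^ j * Binomial.C m j.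
Proof.
intros Hj. unfold Binomial.C.
assert (Hm : forall i, INR (fact i) <> 0) by (intros; apply INR_fact_neq_0).
assert (E : poch (- INR m) j = (-1) ^ j * INR (fact m) / INR (fact (m - j))).
{ induction j as [|j IH].
  - simpl. rewrite Nat.sub_0_r. field. apply Hm.
  - simpl poch. rewrite IH by lia.
    replace (m - j)%nat with (S (m - S j)) by lia.
    assert (E : INR m = INR (S (m - S j)) + INR j).
    { rewrite <- plus_INR. f_equal. lia. }
    rewrite E, fact_simpl, mult_INR. simpl pow. field. split; [apply Hm | now apply not_0_INR]. }
rewrite E. field. split; apply Hm.
Qed.

Lemma poch_one j : poch 1 j = INR (fact j).
Proof.
induction j as [|j IH]; [reflexivity|].
rewrite fact_simpl, mult_INR, S_INR. simpl poch. rewrite IH. ring.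
Qed.

Lemma binomial_one m y : sum_f_R0 (fun j => Binomial.C m j * y ^ j) m = (1 + y) ^ m.
Proof.
rewrite Rplus_comm, binomial. apply sum_eq. intros j _. rewrite pow1. ring.
Qed.

Definition laplace_kernel (c : R) (m : nat) (t : R) : R :=
  exp (- (c * t)) * (1 - t) ^ m / ((1 + t) ^ S m * sqrt (1 + t)).

(** Writing (1 - t)/(1 + t) = 1 - 2t/(1 + t), the binomial theorem expands the kernel in the
    [nmom c j] with coefficients (-2)^j C(m,j). On the other side, the factor [poch (3 / 2) j]
    supplied by [gmom_nmom] cancels the one in the denominator of 1F1: this is where the parameter
    3/2 matters. *)
Lemma laplace_hyp1F1 p b m : 0 < p -> 0 < b ->
  exists u, is_RInt_inf (laplace_kernel (b ^ 2 / (4 * p)) m) 0 u /\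
    is_RInt_inf (fun x => x * exp (- (p * x ^ 2)) * hyp1F1_neg m (3 / 2) (2 * p * x ^ 2)
                   * exp (- (b * x))) 0 (u / (4 * p)).
Proof.
intros Hp Hb. set (c := b ^ 2 / (4 * p)).
(* The value for each j is only known to exist; [RInt_gen] names all of them as one function of j
   without a choice principle. *)
set (U := fun j => RInt_gen (nmom c j) (at_point 0) (Rbar_locally p_infty)).
assert (HU : forall j, is_RInt_inf (nmom c j) 0 (U j) /\
    is_RInt_inf (gmom p b (2 * j + 1)) 0 (poch (3 / 2) j * U j / (4 * p ^ S j))).
{ intros j. destruct (gmom_nmom p b j Hp Hb) as [u [Hu Hu']]. fold c in Hu.
  replace (U j) with u; [exact (conj Hu Hu')|].
  symmetry. exact (is_RInt_inf_RInt_gen (nmom c j) 0 u Hu). }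
assert (HU1 := fun j => proj1 (HU j)). assert (HU2 := fun j => proj2 (HU j)). clear HU.
set (co := fun j => (-1) ^ j * Binomial.C m j * 2 ^ j).
exists (sum_f_R0 (fun j => co j * U j) m). split.
- apply is_RInt_inf_ext with (fun t => sum_f_R0 (fun j => co j * nmom c j t) m).
  2:{ apply (is_RInt_inf_sum (fun j t => co j * nmom c j t)). intros j _.
      apply is_RInt_inf_scal. exact (HU1 j). }
  intros t Ht. unfold laplace_kernel.
  assert (0 < sqrt (1 + t)) by (apply sqrt_lt_R0; lra).
  assert (0 < (1 + t) ^ m) by (apply pow_lt; lra).
  replace (1 - t) with ((1 + - (2 * t / (1 + t))) * (1 + t)) by (field; lra).
  rewrite Rpow_mult_distr, <- binomial_one.
  replace (exp (- (c * t)) * (sum_f_R0 (fun j => Binomial.C m j * (- (2 * t / (1 + t))) ^ j) m *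
      (1 + t) ^ m) / ((1 + t) ^ S m * sqrt (1 + t)))
    with ((exp (- (c * t)) / ((1 + t) * sqrt (1 + t))) *
      sum_f_R0 (fun j => Binomial.C m j * (- (2 * t / (1 + t))) ^ j) m) by (simpl; field; lra).
  rewrite scal_sum. apply sum_eq. intros j _. unfold co, nmom.
  replace (- (2 * t / (1 + t))) with ((-1) * (2 * (t * / (1 + t)))) by (field; lra).
  rewrite !Rpow_mult_distr, pow_inv.
  assert (0 < (1 + t) ^ j) by (apply pow_lt; lra).
  simpl pow. field. lra.
- apply is_RInt_inf_ext with (fun x => sum_f_R0 (fun j =>
    poch (- INR m) j / poch (3 / 2) j * (2 * p) ^ j / INR (fact j) * gmom p b (2 * j + 1) x) m).
  + intros x _. unfold hyp1F1_neg.
    replace (x * exp (- (p * x ^ 2)) * sum_f_R0 (fun j => poch (- INR m) j / poch (3 / 2) j *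
      (2 * p * x ^ 2) ^ j / INR (fact j)) m * exp (- (b * x)))
      with ((x * exp (- (p * x ^ 2)) * exp (- (b * x))) * sum_f_R0 (fun j => poch (- INR m) j / poch (3 / 2) j *
      (2 * p * x ^ 2) ^ j / INR (fact j)) m) by ring.
    rewrite scal_sum. apply sum_eq. intros j _. unfold gmom.
    replace (- (p * x ^ 2 + b * x)) with (- (p * x ^ 2) + - (b * x)) by ring.
    rewrite exp_plus, (Rpow_mult_distr (2 * p)), pow_add, pow_mult, pow_1. unfold Rdiv. ring.
  + replace (sum_f_R0 (fun j => co j * U j) m / (4 * p)) with
      (sum_f_R0 (fun j => poch (- INR m) j / poch (3 / 2) j * (2 * p) ^ j / INR (fact j)
         * (poch (3 / 2) j * U j / (4 * p ^ S j))) m).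
    * apply (is_RInt_inf_sum (fun j x => poch (- INR m) j / poch (3 / 2) j * (2 * p) ^ j / INR (fact j)
         * gmom p b (2 * j + 1) x)). intros j _.
      apply is_RInt_inf_scal. exact (HU2 j).
    * transitivity (/ (4 * p) * sum_f_R0 (fun j => co j * U j) m); [|unfold Rdiv; ring].
      rewrite scal_sum. apply sum_eq. intros j Hj. unfold co.
      rewrite <- poch_neg by exact Hj. rewrite Rpow_mult_distr.
      assert (0 < p ^ j) by now apply pow_lt.
      assert (0 < poch (3 / 2) j) by (apply poch_pos; lra).
      assert (Hf := INR_fact_lt_0 j).
      simpl pow. field. lra.
Qed.

Definition wint (m : nat) : R := RInt (fun w => (1 - w ^ 2) ^ m) 0 1.

Lemma ex_RInt_wint m a b : ex_RInt (fun w => (1 - w ^ 2) ^ m) a b.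
Proof.
apply (@ex_RInt_continuous R_CompleteNormedModule). intros; continuous_auto.
Qed.

(** [wint m] is half the Beta value B(1/2, m + 1). The function w (1 - w^2)^(m+1) vanishes at 0 and
    1; integrating its derivative gives (2m + 3) [wint (S m)] = 2 (m + 1) [wint m]. *)
Lemma wint_poch m : wint m * poch (3 / 2) m = INR (fact m).
Proof.
induction m as [|m IH].
- unfold wint. simpl. rewrite RInt_const. unfold scal; simpl; unfold mult; simpl. ring.
- assert (Hm := pos_INR m).
  assert (R : (2 * INR m + 3) * wint (S m) - 2 * (INR m + 1) * wint m = 0).
  { assert (H : is_RInt (fun w => (2 * INR m + 3) * (1 - w ^ 2) ^ S m - 2 * (INR m + 1) * (1 - w ^ 2) ^ m)
               0 1 (1 * (1 - 1 ^ 2) ^ S m - 0 * (1 - 0 ^ 2) ^ S m)).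
    { apply (is_RInt_derive (fun w => w * (1 - w ^ 2) ^ S m)).
      - intros w _. auto_derive; [exact I|].
        change (match m with 0%nat => 1 | S _ => INR m + 1 end) with (INR (S m)).
        rewrite S_INR. simpl pow. fold (1 - w * (w * 1)). generalize ((1 - w * (w * 1)) ^ m). intros z. ring.
      - intros w _. continuous_auto. }
    assert (H' : is_RInt (fun w => (2 * INR m + 3) * (1 - w ^ 2) ^ S m - 2 * (INR m + 1) * (1 - w ^ 2) ^ m)
               0 1 ((2 * INR m + 3) * wint (S m) - 2 * (INR m + 1) * wint m)).
    { apply (is_RInt_minus (fun w => (2 * INR m + 3) * (1 - w ^ 2) ^ S m)
               (fun w => 2 * (INR m + 1) * (1 - w ^ 2) ^ m)).
      - apply (is_RInt_scal (fun w => (1 - w ^ 2) ^ S m)).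
        apply (@RInt_correct R_CompleteNormedModule), ex_RInt_wint.
      - apply (is_RInt_scal (fun w => (1 - w ^ 2) ^ m)).
        apply (@RInt_correct R_CompleteNormedModule), ex_RInt_wint. }
    rewrite <- (is_RInt_unique _ _ _ _ H'), (is_RInt_unique _ _ _ _ H). simpl. ring. }
  rewrite fact_simpl, mult_INR, <- IH, S_INR. simpl poch.
  replace (wint (S m)) with (2 * (INR m + 1) * wint m / (2 * INR m + 3)) by (field_simplify_eq; lra).
  field. lra.
Qed.

Lemma is_RInt_wint_sum (co : nat -> R) m :
  is_RInt (fun w => sum_f_R0 (fun j => co j * (1 - w ^ 2) ^ j) m) 0 1
    (sum_f_R0 (fun j => co j * wint j) m).
Proof.
assert (H : forall j, is_RInt (fun w => co j * (1 - w ^ 2) ^ j) 0 1 (co j * wint j)).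
{ intros j. apply (is_RInt_scal (fun w => (1 - w ^ 2) ^ j)).
  apply (@RInt_correct R_CompleteNormedModule), ex_RInt_wint. }
induction m as [|m IH]; [apply H|].
apply (is_RInt_plus (fun w => sum_f_R0 (fun j => co j * (1 - w ^ 2) ^ j) m)
         (fun w => co (S m) * (1 - w ^ 2) ^ S m) 0 1); [exact IH | apply H].
Qed.

(** The common primitive of both elementary integrals: u = 1/sqrt(1 + t) gives 1 - 2u^2 = (t - 1)/(t
    + 1), and u = sqrt(t/(1 + t)) gives the opposite. The value at 1/sqrt 2, where t = 1, yields the
    Gamma quotient; the value at 1 yields the 2F1. *)
Definition pint (m : nat) (y : R) : R := RInt (fun u => (1 - 2 * u ^ 2) ^ m) 0 y.

Lemma continuous_pint_integrand m x : continuous (fun u => (1 - 2 * u ^ 2) ^ m) x.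
Proof. continuous_auto. Qed.

Lemma is_derive_pint m x : is_derive (pint m) x ((1 - 2 * x ^ 2) ^ m).
Proof.
apply (is_derive_RInt (fun u => (1 - 2 * u ^ 2) ^ m) (pint m) 0 x).
- apply filter_forall. intros b. apply (@RInt_correct R_CompleteNormedModule).
  apply (@ex_RInt_continuous R_CompleteNormedModule). intros; apply continuous_pint_integrand.
- apply continuous_pint_integrand.
Qed.

Lemma continuous_pint m x : continuous (pint m) x.
Proof. apply (ex_derive_continuous (pint m)). eexists. apply is_derive_pint. Qed.

Lemma pint_half m : pint m (/ sqrt 2) = / sqrt 2 * wint m.
Proof.
assert (Hs : 0 < sqrt 2) by (apply sqrt_lt_R0; lra).
assert (Hss : sqrt 2 ^ 2 = 2) by (simpl; rewrite Rmult_1_r, sqrt_sqrt; lra).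
unfold pint, wint.
transitivity (RInt (fun w => / sqrt 2 * (1 - 2 * (/ sqrt 2 * w + 0) ^ 2) ^ m) 0 1).
- symmetry. etransitivity; [apply (RInt_comp_lin (fun u => (1 - 2 * u ^ 2) ^ m))|].
  + apply (@ex_RInt_continuous R_CompleteNormedModule). intros; apply continuous_pint_integrand.
  + f_equal; ring.
- etransitivity; [|apply (RInt_scal (fun w => (1 - w ^ 2) ^ m)), ex_RInt_wint].
  apply RInt_ext. intros w _. unfold scal; simpl; unfold mult; simpl. f_equal. f_equal.
  replace (2 * ((/ sqrt 2 * w + 0) * ((/ sqrt 2 * w + 0) * 1))) with (2 / sqrt 2 ^ 2 * (w * w))
    by (simpl; field; lra).
  rewrite Hss. field.
Qed.

(** By [wint_poch], (1)_j/(3/2)_j is the integral of (1 - w^2)^j over [0,1]. Under the integral the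
    series sums to (1 - 2(1 - w^2))^m = (-1)^m (1 - 2w^2)^m. *)
Lemma hyp2F1_pint m : hyp2F1_neg m 1 (3 / 2) 2 = (-1) ^ m * pint m 1.
Proof.
unfold hyp2F1_neg.
transitivity (sum_f_R0 (fun j => Binomial.C m j * (-2) ^ j * wint j) m).
{ apply sum_eq. intros j Hj.
  replace (-2) with ((-1) * 2) by ring.
  rewrite Rpow_mult_distr, poch_one.
  assert (0 < poch (3 / 2) j) by (apply poch_pos; lra).
  assert (Hf := INR_fact_lt_0 j).
  replace (wint j) with (INR (fact j) / poch (3 / 2) j) by (rewrite <- wint_poch; field; lra).
  transitivity (((-1) ^ j * Binomial.C m j) * (2 ^ j * (INR (fact j) / poch (3 / 2) j))); [|ring].
  rewrite <- poch_neg by exact Hj. field. lra. }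
assert (H : is_RInt (fun w => sum_f_R0 (fun j => Binomial.C m j * (-2) ^ j * (1 - w ^ 2) ^ j) m) 0 1
  (sum_f_R0 (fun j => Binomial.C m j * (-2) ^ j * wint j) m)).
{ apply (is_RInt_wint_sum (fun j => Binomial.C m j * (-2) ^ j)). }
rewrite <- (is_RInt_unique _ _ _ _ H). unfold pint.
etransitivity; [|apply (RInt_scal (fun u => (1 - 2 * u ^ 2) ^ m))].
- apply RInt_ext. intros w _.
  transitivity ((1 + -2 * (1 - w ^ 2)) ^ m).
  + rewrite <- binomial_one. apply sum_eq. intros j _. rewrite Rpow_mult_distr. apply Rmult_assoc.
  + unfold scal; simpl; unfold mult; simpl. rewrite <- Rpow_mult_distr. f_equal. ring.
- apply (@ex_RInt_continuous R_CompleteNormedModule). intros; apply continuous_pint_integrand.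
Qed.

Definition beta_kernel (m : nat) (t : R) : R := (t - 1) ^ m / ((1 + t) ^ S m * sqrt (1 + t)).

Lemma sqrt_facts t : 0 < t -> 0 < sqrt (1 + t) /\ 1 + t = sqrt (1 + t) ^ 2 /\ 0 < sqrt t /\ t = sqrt t ^ 2.
Proof.
intros Ht. repeat split; try (apply sqrt_lt_R0; lra); simpl; rewrite Rmult_1_r, sqrt_sqrt; lra.
Qed.

Lemma continuous_beta_kernel m t : 0 < t -> continuous (beta_kernel m) t.
Proof.
intros Ht. destruct (sqrt_facts t Ht) as [H _]. unfold beta_kernel.
assert (0 < (1 + t) ^ m) by (apply pow_lt; lra).
apply (@ex_derive_continuous R_AbsRing R_NormedModule). auto_derive.
repeat split; try lra. simpl. apply Rgt_not_eq. repeat apply Rmult_lt_0_compat; lra.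
Qed.

Lemma is_lim_inv_sqrt : is_lim (fun t => / sqrt (1 + t)) p_infty 0.
Proof.
replace (Finite 0) with (Rbar_inv p_infty) by reflexivity.
apply is_lim_inv; [|discriminate]. apply (is_lim_sqrt_p (fun t => 1 + t)).
apply (is_lim_le_p_loc (fun t => t)); [exists 0; intros; lra | apply is_lim_id].
Qed.

Lemma is_RInt_inf_beta_kernel m : is_RInt_inf (beta_kernel m) 1 (sqrt 2 * wint m).
Proof.
replace (sqrt 2 * wint m) with (- 2 * pint m 0 - - 2 * pint m (/ sqrt (1 + 1))).
2:{ replace (1 + 1) with 2 by ring. rewrite pint_half. unfold pint at 1.
    replace (RInt (fun u => (1 - 2 * u ^ 2) ^ m) 0 0) with 0
      by (symmetry; apply (@RInt_point R_CompleteNormedModule)).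
    assert (Hs : 0 < sqrt 2) by (apply sqrt_lt_R0; lra).
    symmetry. transitivity (sqrt 2 * sqrt 2 / sqrt 2 * wint m); [field; lra|].
    rewrite sqrt_sqrt by lra. field. lra. }
apply (is_RInt_inf_derive _ (fun t => - 2 * pint m (/ sqrt (1 + t)))).
- intros t Ht. destruct (sqrt_facts t) as [Hs [Hss _]]; [lra|].
  auto_derive.
  + repeat split; try lra. eexists. apply is_derive_pint.
  + rewrite (is_derive_unique (pint m) _ _ (is_derive_pint m _)).
    unfold beta_kernel. replace (1 - 2 * (/ sqrt (1 + t)) ^ 2) with ((t - 1) * / (1 + t)).
    2:{ rewrite pow_inv, <- Hss. field. lra. }
    rewrite Rpow_mult_distr, pow_inv.
    assert (Hp : 0 < (1 + t) ^ m) by (apply pow_lt; lra). revert Hp.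
    simpl pow. generalize ((1 + t) ^ m), ((t - 1) ^ m). intros A B HA.
    revert Hs Hss. generalize (sqrt (1 + t)). intros s Hs Hss.
    replace (1 + t) with (s ^ 2) by lra. field. lra.
- intros t Ht. apply continuous_beta_kernel. lra.
- apply (is_lim_scal_l (fun t => pint m (/ sqrt (1 + t))) (-2) p_infty (pint m 0)).
  apply (is_lim_comp_continuous (fun t => / sqrt (1 + t)) (pint m)).
  + apply is_lim_inv_sqrt.
  + apply continuous_pint.
Qed.

Lemma continuous_beta_kernel_sqrt m t : 0 < t -> continuous (fun t => beta_kernel m t / sqrt t) t.
Proof.
intros Ht. apply (continuous_mult (beta_kernel m) (fun t => / sqrt t)).
- now apply continuous_beta_kernel.
- destruct (sqrt_facts t Ht) as [_ [_ [H _]]].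
  apply (@ex_derive_continuous R_AbsRing R_NormedModule). auto_derive. lra.
Qed.

(** Here u = sqrt(t/(1 + t)) rises from 1/sqrt 2 to 1, and 1 - 2u^2 = -(t - 1)/(1 + t) brings the
    sign (-1)^m. *)
Lemma is_RInt_inf_beta_kernel_sqrt m :
  is_RInt_inf (fun t => beta_kernel m t / sqrt t) 1
    (2 * (-1) ^ m * pint m 1 - 2 * (-1) ^ m * (/ sqrt 2 * wint m)).
Proof.
replace (2 * (-1) ^ m * (/ sqrt 2 * wint m)) with (2 * (-1) ^ m * pint m (sqrt 1 / sqrt (1 + 1))).
2:{ replace (1 + 1) with 2 by ring. rewrite <- pint_half, sqrt_1. do 2 f_equal. field.
    apply Rgt_not_eq, sqrt_lt_R0. lra. }
apply (is_RInt_inf_derive _ (fun t => 2 * (-1) ^ m * pint m (sqrt t / sqrt (1 + t)))).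
- intros t Ht. destruct (sqrt_facts t) as [Hs [Hss [Hr Hrr]]]; [lra|].
  auto_derive.
  + repeat split; try lra. eexists. apply is_derive_pint.
  + rewrite (is_derive_unique (pint m) _ _ (is_derive_pint m _)).
    unfold beta_kernel. replace (1 - 2 * (sqrt t * / sqrt (1 + t)) ^ 2) with ((-1) * ((t - 1) * / (1 + t))).
    2:{ rewrite Rpow_mult_distr, pow_inv, <- Hss, <- Hrr. field. lra. }
    rewrite !Rpow_mult_distr, pow_inv.
    assert (Hp : 0 < (1 + t) ^ m) by (apply pow_lt; lra). revert Hp.
    simpl pow. generalize ((1 + t) ^ m), ((t - 1) ^ m). intros A B HA.
    assert (H1 : (-1) ^ m * (-1) ^ m = 1) by (rewrite <- Rpow_mult_distr; replace (-1 * -1) with 1 by ring; apply pow1).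
    revert Hs Hss Hr Hrr. generalize (sqrt (1 + t)), (sqrt t). intros s r Hs Hss Hr Hrr.
    assert (Hsr : s ^ 2 - r ^ 2 = 1) by lra.
    replace (1 + t) with (s ^ 2) by lra.
    transitivity (((-1) ^ m * (-1) ^ m) * (s ^ 2 - r ^ 2) * (B / (A * r * s ^ 3))); [field; lra|].
    rewrite H1, Hsr. field. lra.
- intros t Ht. apply continuous_beta_kernel_sqrt. lra.
- apply (is_lim_scal_l (fun t => pint m (sqrt t / sqrt (1 + t))) _ p_infty (pint m 1)).
  apply (is_lim_comp_continuous (fun t => sqrt t / sqrt (1 + t)) (pint m)); [|apply continuous_pint].
  apply (is_lim_le_le_loc (fun t => 1 - / sqrt (1 + t)) (fun _ => 1)).
  + exists 1. intros t Ht. destruct (sqrt_facts t) as [Hs [Hss [Hr Hrr]]]; [lra|].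
    revert Hs Hss Hr Hrr. generalize (sqrt (1 + t)), (sqrt t). intros s r Hs Hss Hr Hrr.
    split; apply Rmult_le_reg_r with s; try lra.
    * replace ((1 - / s) * s) with (s - 1) by (field; lra). replace (r / s * s) with r by (field; lra). nra.
    * replace (r / s * s) with r by (field; lra). nra.
  + replace (Finite 1) with (Finite (1 - 0)) by (f_equal; ring).
    apply is_lim_minus'; [apply is_lim_const | apply is_lim_inv_sqrt].
  + apply is_lim_const.
Qed.

(** * The lazy random walk and roots of unity *)

(* The law of the lazy random walk on the integers: [walk m r = 'C(2m, m+r) / 4^m]. *)
Fixpoint walk (m r : nat) : R :=
  match m, r with
  | O, O => 1
  | O, S _ => 0
  | S m', O => (walk m' 0 + walk m' 1) / 2
  | S m', S r' => walk m' r / 2 + (walk m' r' + walk m' (S r)) / 4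
  end.

Lemma walk_ge_0 m r : 0 <= walk m r.
Proof.
revert r. induction m as [|m IH]; intros [|r]; simpl; try lra.
- generalize (IH 0%nat), (IH 1%nat). lra.
- generalize (IH r), (IH (S r)), (IH (S (S r))). lra.
Qed.

Lemma walk_out m r : (m < r)%nat -> walk m r = 0.
Proof.
revert r. induction m as [|m IH]; intros [|r] Hr; simpl; try lia; [reflexivity|].
rewrite !IH by lia. field.
Qed.

(** The ratio of neighbouring binomial coefficients, cleared of denominators so that it stays valid
    for r >= m, where both sides vanish. *)
Lemma walk_ratio m r : walk m (S r) * (INR m + INR r + 1) = walk m r * (INR m - INR r).
Proof.
revert r. induction m as [|m IH]; intros r.
- destruct r as [|r]; simpl; ring.
- rewrite S_INR. destruct r as [|r].
  + assert (H0 := IH 0%nat). assert (H1 := IH 1%nat). simpl INR in *. simpl walk. nra.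
  + assert (H0 := IH r). assert (H1 := IH (S r)). assert (H2 := IH (S (S r))).
    rewrite !S_INR in *. simpl walk. nra.
Qed.

Lemma walk_0_pos m : 0 < walk m 0.
Proof.
induction m as [|m IH]; simpl; [lra|]. generalize (walk_ge_0 m 1). lra.
Qed.

Lemma walk_S_0 m : walk (S m) 0 = walk m 0 * ((2 * INR m + 1) / (2 * INR m + 2)).
Proof.
assert (H := walk_ratio m 0). assert (Hm := pos_INR m). simpl INR in H. simpl walk.
replace (walk m 1) with (walk m 0 * INR m / (INR m + 1)).
- field. lra.
- rewrite Rplus_0_r, Rminus_0_r in H. rewrite <- H. field. lra.
Qed.

Lemma exp_le_compat x y : x <= y -> exp x <= exp y.
Proof.
intros [H| ->]; [apply Rlt_le, exp_increasing, H | apply Rle_refl].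
Qed.

(** The ratio of neighbours is 1 - (2k + 1)/(m + k + 1), at most exp(-(2k + 1)/(m + r)) for k < r.
    The odd numbers 2k + 1 sum to r^2. The denominator is frozen at the final [r], so the induction
    runs over k <= r. *)
Lemma walk_upper m r : (0 < m)%nat ->
  walk m r <= walk m 0 * exp (- (INR r ^ 2 / (INR m + INR r))).
Proof.
intros Hm. apply lt_INR in Hm. simpl in Hm.
assert (H : forall k, (k <= r)%nat -> walk m k <= walk m 0 * exp (- (INR k ^ 2 / (INR m + INR r)))).
2:{ now apply H. }
induction k as [|k IH]; intros Hk.
- simpl. replace (- (0 * (0 * 1) / (INR m + INR r))) with 0 by (field; generalize (pos_INR r); lra).
  rewrite exp_0. lra.
- assert (Hk' : INR k + 1 <= INR r) by (rewrite <- S_INR; now apply le_INR).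
  assert (Hk0 := pos_INR k). specialize (IH ltac:(lia)).
  assert (E : walk m (S k) <= walk m k * exp (- ((2 * INR k + 1) / (INR m + INR r)))).
  { apply Rle_trans with (walk m k * exp (- ((2 * INR k + 1) / (INR m + INR k + 1)))).
    - replace (walk m (S k)) with (walk m k * (1 + - ((2 * INR k + 1) / (INR m + INR k + 1)))).
      + apply Rmult_le_compat_l; [apply walk_ge_0|]. apply exp_ineq1_le.
      + apply Rmult_eq_reg_r with (INR m + INR k + 1); [|lra].
        rewrite walk_ratio. field. lra.
    - apply Rmult_le_compat_l; [apply walk_ge_0|]. apply exp_le_compat, Ropp_le_contravar.
      apply Rmult_le_compat_l; [lra|]. apply Rinv_le_contravar; lra. }
  apply Rle_trans with (1 := E).
  apply Rle_trans with (walk m 0 * exp (- (INR k ^ 2 / (INR m + INR r))) *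
     exp (- ((2 * INR k + 1) / (INR m + INR r)))).
  + apply Rmult_le_compat_r; [apply Rlt_le, exp_pos | exact IH].
  + rewrite Rmult_assoc, <- exp_plus, S_INR. apply Req_le. do 2 f_equal. field. lra.
Qed.

(** Dual to the upper bound: the ratio is also 1/(1 + (2k + 1)/(m - k)), at least exp(-(2k + 1)/(m -
    r)). *)
Lemma walk_lower m r : (r < m)%nat ->
  walk m 0 * exp (- (INR r ^ 2 / (INR m - INR r))) <= walk m r.
Proof.
intros Hm. apply lt_INR in Hm.
assert (H : forall k, (k <= r)%nat -> walk m 0 * exp (- (INR k ^ 2 / (INR m - INR r))) <= walk m k).
2:{ now apply H. }
induction k as [|k IH]; intros Hk.
- simpl. replace (- (0 * (0 * 1) / (INR m - INR r))) with 0 by (field; lra).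
  rewrite exp_0. lra.
- assert (Hk' : INR k + 1 <= INR r) by (rewrite <- S_INR; now apply le_INR).
  assert (Hk0 := pos_INR k). specialize (IH ltac:(lia)).
  assert (E : walk m k * exp (- ((2 * INR k + 1) / (INR m - INR r))) <= walk m (S k)).
  { apply Rle_trans with (walk m k * / (1 + (2 * INR k + 1) / (INR m - INR k))).
    - apply Rmult_le_compat_l; [apply walk_ge_0|]. rewrite exp_Ropp.
      assert (0 < (2 * INR k + 1) / (INR m - INR k)) by (apply Rdiv_lt_0_compat; lra).
      apply Rinv_le_contravar; [lra|].
      apply Rle_trans with (exp ((2 * INR k + 1) / (INR m - INR k))); [apply exp_ineq1_le|].
      apply exp_le_compat. apply Rmult_le_compat_l; [lra|]. apply Rinv_le_contravar; lra.
    - apply Req_le, Rmult_eq_reg_r with (INR m + INR k + 1); [|lra].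
      rewrite walk_ratio. field. lra. }
  apply Rle_trans with (2 := E).
  apply Rle_trans with (walk m 0 * exp (- (INR k ^ 2 / (INR m - INR r))) *
     exp (- ((2 * INR k + 1) / (INR m - INR r)))).
  + rewrite Rmult_assoc, <- exp_plus, S_INR. apply Req_le. do 2 f_equal. field. lra.
  + apply Rmult_le_compat_r; [apply Rlt_le, exp_pos | exact IH].
Qed.

(** cos^2 x = 1/2 + cos(2x)/2 is the characteristic function of one lazy step at the angle 2x, so
    its powers have the law of the walk as Fourier coefficients; symmetry folds them onto r >= 0.
    The free bound [N] allows padding by zeros. *)
Lemma walk_cos m N x : (m <= N)%nat ->
  cos x ^ (2 * m) =
  walk m 0 + 2 * sum_f_R0 (fun r => walk m (S r) * cos ((INR r + 1) * (2 * x))) N.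
Proof.
revert N. induction m as [|m IH]; intros N HN.
- simpl. rewrite (sum_eq _ (fun _ => 0 * 0)), <- scal_sum; [ring | intros; ring].
- replace (cos x ^ (2 * S m)) with (cos x ^ 2 * cos x ^ (2 * m)) by (rewrite <- pow_add; f_equal; lia).
  rewrite (IH N) by lia.
  (* Multiplication by cos^2 acts on the coefficients of any cosine sum as one step of the walk. The
     last two terms are truncation errors; they vanish for [walk m] because m lies below the cut. *)
  assert (B : forall (p : nat -> R) n,
    cos x ^ 2 * (p O + 2 * sum_f_R0 (fun r => p (S r) * cos ((INR r + 1) * (2 * x))) n) =
    (p O + p 1%nat) / 2 + 2 * sum_f_R0 (fun r =>
      (p (S r) / 2 + (p r + p (S (S r))) / 4) * cos ((INR r + 1) * (2 * x))) n
    + p (S n) * cos ((INR n + 2) * (2 * x)) / 2 - p (S (S n)) * cos ((INR n + 1) * (2 * x)) / 2).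
  { intros p.
    assert (P : forall y, cos x ^ 2 * cos y = cos y / 2 + (cos (y + 2 * x) + cos (y - 2 * x)) / 4).
    { intros y. rewrite cos_plus, cos_minus, (cos_2a_cos x). field. }
    assert (P0 : cos x ^ 2 = / 2 + cos (2 * x) / 2) by (rewrite cos_2a_cos; field).
    induction n as [|n IHn].
    - simpl sum_f_R0. simpl INR. rewrite Rmult_plus_distr_l.
      replace (cos x ^ 2 * (2 * (p 1%nat * cos ((0 + 1) * (2 * x)))))
        with (2 * p 1%nat * (cos x ^ 2 * cos ((0 + 1) * (2 * x)))) by ring.
      rewrite P, P0. replace ((0 + 1) * (2 * x) - 2 * x) with 0 by ring. rewrite cos_0.
      replace ((0 + 1) * (2 * x) + 2 * x) with ((0 + 2) * (2 * x)) by ring.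
      replace ((0 + 1) * (2 * x)) with (2 * x) by ring. field.
    - rewrite !tech5. rewrite S_INR.
      match goal with |- cos x ^ 2 * (?a + 2 * (?b + ?c * ?d)) = _ =>
        transitivity (cos x ^ 2 * (a + 2 * b) + 2 * c * (cos x ^ 2 * d)); [ring|] end.
      rewrite IHn, P.
      replace ((INR n + 1 + 1) * (2 * x) + 2 * x) with ((INR n + 1 + 2) * (2 * x)) by ring.
      replace ((INR n + 1 + 1) * (2 * x) - 2 * x) with ((INR n + 1) * (2 * x)) by ring.
      replace ((INR n + 1 + 1) * (2 * x)) with ((INR n + 2) * (2 * x)) by ring.
      field. }
  rewrite (B (walk m)), (walk_out m (S N)), (walk_out m (S (S N))) by lia.
  simpl walk. field.
Qed.

Lemma dirichlet_kernel q x :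
  sin (x / 2) * (1 + 2 * sum_f_R0 (fun l => cos ((INR l + 1) * x)) q) = sin ((INR q + 3 / 2) * x).
Proof.
assert (P : forall y, 2 * sin (x / 2) * cos y = sin (y + x / 2) - sin (y - x / 2)).
{ intros y. rewrite sin_plus, sin_minus. ring. }
induction q as [|q IH].
- simpl sum_f_R0. simpl INR.
  transitivity (sin (x / 2) + 2 * sin (x / 2) * cos ((0 + 1) * x)); [ring|]. rewrite P.
  replace ((0 + 1) * x - x / 2) with (x / 2) by field.
  replace ((0 + 1) * x + x / 2) with ((0 + 3 / 2) * x) by field. ring.
- rewrite !tech5, S_INR.
  transitivity (sin (x / 2) * (1 + 2 * sum_f_R0 (fun l => cos ((INR l + 1) * x)) q)
    + 2 * sin (x / 2) * cos ((INR q + 1 + 1) * x)); [ring|].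
  rewrite IH, P.
  replace ((INR q + 1 + 1) * x - x / 2) with ((INR q + 3 / 2) * x) by field.
  replace ((INR q + 1 + 1) * x + x / 2) with ((INR q + 1 + 3 / 2) * x) by field. ring.
Qed.

Lemma sin_INR_PI n : sin (INR n * PI) = 0.
Proof.
induction n as [|n IH]; [simpl; rewrite Rmult_0_l; apply sin_0|].
rewrite S_INR, Rmult_plus_distr_r, Rmult_1_l, neg_sin, IH. ring.
Qed.

Lemma cos_2INR_PI n : cos (INR n * (2 * PI)) = 1.
Proof.
replace (INR n * (2 * PI)) with (0 + 2 * INR n * PI) by ring.
rewrite cos_period. apply cos_0.
Qed.

(** For odd n = 2q + 3 the roots of unity other than 1 form q + 1 conjugate pairs, so this is the
    full sum of r-th powers. If n does not divide r, the Dirichlet kernel gives sin(pi r/n) times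
    the sum = sin(pi r) = 0, and the first factor is not zero. *)
Lemma roots_sum q r :
  let n := (2 * q + 3)%nat in
  1 + 2 * sum_f_R0 (fun l => cos ((INR l + 1) * (2 * (INR r * (PI / INR n))))) q =
  if Nat.eqb (r mod n) 0 then INR n else 0.
Proof.
intros n.
assert (Hn0 : n <> 0%nat) by (unfold n; lia).
assert (Hn : INR n = 2 * INR q + 3).
{ unfold n. rewrite plus_INR, mult_INR. simpl. ring. }
assert (Hq := pos_INR q). assert (HPI := PI_RGT_0).
destruct (Nat.eqb_spec (r mod n) 0) as [E|E].
- apply Nat.Div0.div_exact in E. set (d := (r / n)%nat) in E.
  rewrite (sum_eq _ (fun _ => 1)).
  + rewrite sum_cte, S_INR, Hn. ring.
  + intros l _. rewrite E, mult_INR.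
    replace ((INR l + 1) * (2 * (INR n * INR d * (PI / INR n)))) with (INR (S l * d) * (2 * PI)).
    * apply cos_2INR_PI.
    * rewrite mult_INR, S_INR. field. lra.
- set (x := 2 * (INR r * (PI / INR n))).
  assert (D := dirichlet_kernel q x).
  replace ((INR q + 3 / 2) * x) with (INR r * PI) in D by (unfold x; rewrite Hn; field; lra).
  rewrite sin_INR_PI in D.
  destruct (Rmult_integral _ _ D) as [D'|D']; [exfalso|exact D'].
  set (d := (r / n)%nat). set (e := (r mod n)%nat) in *.
  assert (Hr : r = (n * d + e)%nat) by (apply Nat.div_mod; exact Hn0).
  assert (He : (e < n)%nat) by (apply Nat.mod_upper_bound; exact Hn0).
  assert (Hx : x / 2 = INR e * (PI / INR n) + INR d * PI).
  { unfold x. rewrite Hr, plus_INR, mult_INR. field. lra. }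
  rewrite Hx, sin_plus, sin_INR_PI in D'.
  assert (Hs : 0 < sin (INR e * (PI / INR n))).
  { apply lt_INR in He. assert (0 < INR e) by (apply lt_0_INR; lia).
    apply sin_gt_0.
    - apply Rmult_lt_0_compat; [lra|]. apply Rdiv_lt_0_compat; lra.
    - apply Rmult_lt_reg_r with (INR n); [lra|].
      replace (INR e * (PI / INR n) * INR n) with (INR e * PI) by (field; lra). nra. }
  assert (Hc : cos (INR d * PI) <> 0).
  { intros Hc. assert (H := sin2_cos2 (INR d * PI)). rewrite sin_INR_PI, Hc in H.
    unfold Rsqr in H. lra. }
  rewrite Rmult_0_r, Rplus_0_r in D'. apply Rmult_integral in D'. lra.
Qed.

(** The bound [n * S K - 1] makes [S r] run through K + 1 full blocks of length n; the only multiple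
    of n in a block is its last element. *)
Lemma sum_multiples (f : nat -> R) n K : (0 < n)%nat ->
  (forall r, (r mod n <> 0)%nat -> f r = 0) ->
  sum_f_R0 (fun r => f (S r)) (n * S K - 1) = sum_f_R0 (fun j => f (n * S j)%nat) K.
Proof.
intros Hn Hf.
assert (L : forall h d, (forall i, (i < d)%nat -> h i = 0) -> sum_f_R0 h d = h d).
{ intros h d Hd. destruct d as [|d]; [reflexivity|]. rewrite tech5.
  rewrite (sum_eq _ (fun _ => 0 * 0)), <- scal_sum; [ring|]. intros i Hi. rewrite Hd by lia. ring. }
induction K as [|K IH].
- rewrite Nat.mul_1_r. rewrite L.
  + simpl. f_equal. lia.
  + intros i Hi. apply Hf. rewrite Nat.mod_small; lia.
- rewrite tech5, <- IH, (tech2 _ (n * S K - 1)) by nia.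
  f_equal. replace (n * S (S K) - 1 - S (n * S K - 1))%nat with (n - 1)%nat by nia.
  rewrite L.
  + f_equal. nia.
  + intros i Hi. apply Hf.
    replace (S (S (n * S K - 1) + i))%nat with (S i + (S K) * n)%nat by nia.
    rewrite Nat.Div0.mod_add, Nat.mod_small; lia.
Qed.

Lemma sum_sum_switch (a : nat -> R) (c : nat -> nat -> R) N q :
  sum_f_R0 (fun l => sum_f_R0 (fun r => a r * c r l) N) q =
  sum_f_R0 (fun r => a r * sum_f_R0 (c r) q) N.
Proof.
induction q as [|q IH]; [reflexivity|].
rewrite tech5, IH, <- plus_sum. apply sum_eq. intros i _. rewrite tech5. ring.
Qed.

(* A power of the cosine, summed over the [n]-th roots of unity, samples the walk at the multiples of [n]. *)
Lemma polya_identity m q :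
  let n := (2 * q + 3)%nat in
  1 + 2 * sum_f_R0 (fun l => cos ((INR l + 1) * (PI / INR n)) ^ (2 * m)) q =
  INR n * (walk m 0 + 2 * sum_f_R0 (fun j => walk m (n * S j)) m).
Proof.
(* The cosine expansion is padded up to a whole number of blocks of length n, as [sum_multiples]
   requires. *)
intros n. set (N := (n * S m - 1)%nat).
assert (HN : (m <= N)%nat) by (unfold N, n; nia).
assert (Hn : INR n = 2 * INR q + 3).
{ unfold n. rewrite plus_INR, mult_INR. simpl. ring. }
rewrite (sum_eq _ (fun l => walk m 0 + 2 * sum_f_R0 (fun r =>
  walk m (S r) * cos ((INR l + 1) * (2 * (INR (S r) * (PI / INR n))))) N)).
2:{ intros l _. rewrite (walk_cos m N) by exact HN. do 2 f_equal.
    apply sum_eq. intros r _. do 2 f_equal. rewrite S_INR. ring. }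
rewrite plus_sum, sum_cte.
rewrite (sum_eq (fun l => 2 * _) (fun l => sum_f_R0 (fun r =>
  walk m (S r) * cos ((INR l + 1) * (2 * (INR (S r) * (PI / INR n))))) N * 2)) by (intros; ring).
rewrite <- scal_sum.
rewrite (sum_sum_switch (fun r => walk m (S r))
  (fun r l => cos ((INR l + 1) * (2 * (INR (S r) * (PI / INR n))))) N q).
(* At x = 0 the expansion says that the walk has total mass 1; this rewrites the leading 1, the root
   of unity 1, as a sum over the walk. *)
assert (W := walk_cos m N 0 HN). rewrite cos_0, pow1 in W.
rewrite (sum_eq (fun r => walk m (S r) * cos ((INR r + 1) * (2 * 0))) (fun r => walk m (S r))) in W.
2:{ intros r _. rewrite !Rmult_0_r, cos_0. ring. }
set (S2 := sum_f_R0 _ N). set (S1 := sum_f_R0 _ N) in W.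
set (f := fun r => if Nat.eqb (r mod n) 0 then walk m r else 0).
assert (E : S1 + 2 * S2 = INR n * sum_f_R0 (fun r => f (S r)) N).
{ unfold S1, S2. rewrite (scal_sum (fun r => f (S r))), (scal_sum _ N 2), <- plus_sum.
  apply sum_eq. intros r _. unfold f.
  transitivity (walk m (S r) *
    (1 + 2 * sum_f_R0 (fun l => cos ((INR l + 1) * (2 * (INR (S r) * (PI / INR n))))) q)); [ring|].
  assert (H := roots_sum q (S r)). cbv zeta in H. fold n in H. rewrite H.
  destruct Nat.eqb; ring. }
unfold N in E. rewrite sum_multiples in E.
- rewrite (sum_eq (fun j => f (n * S j)%nat) (fun j => walk m (n * S j))) in E.
  + rewrite S_INR. transitivity (walk m 0 * (2 * INR q + 3) + 2 * (S1 + 2 * S2)).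
    * rewrite W at 1. ring.
    * rewrite E, Hn. ring.
  + intros j _. unfold f. rewrite Nat.mul_comm, Nat.Div0.mod_mul. reflexivity.
- unfold n; lia.
- intros r Hr. unfold f. destruct (Nat.eqb_spec (r mod n) 0); [contradiction | reflexivity].
Qed.

(** * Dominated convergence of series and bounds for sine and cosine *)

Lemma Series_tail_bound (a u : nat -> R) N : ex_series u -> (forall l, Rabs (a l) <= u l) ->
  Rabs (Series a - sum_f_R0 a N) <= Series u - sum_f_R0 u N.
Proof.
intros Hu Ha.
assert (Hea : ex_series a) by now apply (ex_series_le a u).
rewrite (Series_incr_n a (S N)), (Series_incr_n u (S N)) by (lia || assumption). simpl pred.
match goal with |- Rabs ?x <= ?y =>
  replace x with (Series (fun k => a (S N + k)%nat)) by ring;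
  replace y with (Series (fun k => u (S N + k)%nat)) by ring end.
apply Rle_trans with (Series (fun k => Rabs (a (S N + k)%nat))).
- apply Series_Rabs. apply (ex_series_le (fun k => Rabs (a (S N + k)%nat)) (fun k => u (S N + k)%nat)).
  + intros k. unfold norm; simpl. unfold abs; simpl. rewrite Rabs_Rabsolu. apply Ha.
  + now apply ex_series_incr_n.
- apply Series_le; [|now apply ex_series_incr_n].
  intros k. split; [apply Rabs_pos | apply Ha].
Qed.

Lemma is_lim_seq_sum_f_R0 a : ex_series a -> is_lim_seq (sum_f_R0 a) (Series a).
Proof.
intros Ha. apply (is_lim_seq_ext (sum_n a)); [intros; apply sum_n_Reals|].
apply (Series_correct a Ha).
Qed.

Lemma Series_finite a K : (forall l, (K < l)%nat -> a l = 0) -> Series a = sum_f_R0 a K.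
Proof.
intros Ha.
assert (H : is_lim_seq (sum_n a) (sum_f_R0 a K)).
{ apply (is_lim_seq_ext_loc (fun _ => sum_f_R0 a K)); [|apply is_lim_seq_const].
  exists K. intros n Hn. rewrite sum_n_Reals. induction Hn as [|n Hn IH]; [reflexivity|].
  rewrite tech5, <- IH, Ha by lia. ring. }
unfold Series. now rewrite (is_lim_seq_unique _ _ H).
Qed.

(** Dominated convergence for series. The growing range of summation is encoded by terms that vanish
    beyond [K q], so each finite sum is itself a [Series]. *)
Lemma tannery (b : nat -> nat -> R) (c u : nat -> R) (K : nat -> nat) :
  ex_series u -> (forall q l, Rabs (b q l) <= u l) ->
  (forall l, is_lim_seq (fun q => b q l) (c l)) ->
  (forall q l, (K q < l)%nat -> b q l = 0) ->
  is_lim_seq (fun q => sum_f_R0 (b q) (K q)) (Series c).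
Proof.
intros Hu Hb Hc HK.
assert (Hcu : forall l, Rabs (c l) <= u l).
{ intros l. apply (is_lim_seq_le (fun q => Rabs (b q l)) (fun _ => u l) (Rabs (c l)) (u l)).
  - intros q. apply Hb.
  - apply (is_lim_seq_abs (fun q => b q l) (c l)), Hc.
  - apply is_lim_seq_const. }
apply is_lim_seq_spec. intros eps.
assert (Ht := is_lim_seq_sum_f_R0 u Hu). apply is_lim_seq_spec in Ht.
(* A quarter of [eps] for each of the two tails, and half of it below for the first [L + 1]
   terms. *)
destruct (Ht (mkposreal _ (is_pos_div_2 (pos_div_2 eps)))) as [L HL].
specialize (HL L (Nat.le_refl L)). simpl in HL.
assert (Hs : is_lim_seq (fun q => sum_f_R0 (b q) L) (sum_f_R0 c L)).
{ clear HL. induction L as [|L IH]; [apply Hc|].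
  apply (is_lim_seq_plus' (fun q => sum_f_R0 (b q) L) (fun q => b q (S L))); [exact IH | apply Hc]. }
apply is_lim_seq_spec in Hs. destruct (Hs (pos_div_2 eps)) as [q0 Hq0].
exists q0. intros q Hq. specialize (Hq0 q Hq). simpl in Hq0.
rewrite <- (Series_finite (b q) (K q)) by apply HK.
assert (T1 := Series_tail_bound (b q) u L Hu (Hb q)).
assert (T2 := Series_tail_bound c u L Hu Hcu).
revert HL Hq0 T1 T2. unfold Rabs; repeat destruct Rcase_abs; lra.
Qed.

(** A weak form of Jordan's inequality, from the Taylor lower bound of degree 7. The constant 1/3 is
    enough: at x = (l + 1) pi/n it gives sin x >= (l + 1)/n because pi > 3. *)
Lemma sin_ge_third x : 0 <= x <= PI / 2 -> x / 3 <= sin x.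
Proof.
intros Hx. assert (HP := PI_4). assert (HP0 := PI_RGT_0).
apply Rle_trans with (sin_lb x); [|apply SIN; lra].
unfold sin_lb, sin_approx, sin_term, sum_f_R0.
replace (INR (fact (2 * 0 + 1))) with 1 by reflexivity.
replace (INR (fact (2 * 1 + 1))) with 6 by (rewrite INR_IZR_INZ; reflexivity).
replace (INR (fact (2 * 2 + 1))) with 120 by (rewrite INR_IZR_INZ; reflexivity).
replace (INR (fact (2 * 3 + 1))) with 5040 by (rewrite INR_IZR_INZ; reflexivity).
simpl pow.
assert (Hy : 0 <= x * x <= 4) by nra.
match goal with |- _ <= ?e =>
  replace e with (x / 3 + (x * (2 / 3 - x * x / 6) + x * (x * x) * (x * x) / 120 * (1 - x * x / 42)))
    by field end.
assert (0 <= x * (2 / 3 - x * x / 6)) by (apply Rmult_le_pos; lra).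
assert (0 <= x * (x * x) * (x * x) / 120 * (1 - x * x / 42)).
{ apply Rmult_le_pos; [|lra]. apply Rmult_le_pos; [|lra]. repeat apply Rmult_le_pos; lra. }
lra.
Qed.

Lemma exp_pow x n : exp x ^ n = exp (INR n * x).
Proof.
induction n as [|n IH]; [simpl; rewrite Rmult_0_l, exp_0; reflexivity|].
rewrite S_INR, Rmult_plus_distr_r, exp_plus, Rmult_1_l, <- IH. simpl. ring.
Qed.

(** Both bounds are 1 + y <= exp y: with y = -sin^2 x for cos^2 x = 1 - sin^2 x, and with y = tan^2
    x for 1/cos^2 x = 1 + tan^2 x. *)
Lemma cos_pow_bounds m x : 0 < cos x ->
  exp (- (INR m * (sin x / cos x) ^ 2)) <= cos x ^ (2 * m) <= exp (- (INR m * sin x ^ 2)).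
Proof.
intros Hc. assert (H := sin2_cos2 x). unfold Rsqr in H.
rewrite pow_mult, !Ropp_mult_distr_r, <- !exp_pow.
split; apply pow_incr; split; try (apply Rlt_le, exp_pos).
- rewrite exp_Ropp. replace (cos x ^ 2) with (/ / cos x ^ 2) by (field; lra).
  apply Rinv_le_contravar; [apply Rinv_0_lt_compat; nra|].
  apply Rle_trans with (1 + (sin x / cos x) ^ 2); [|apply exp_ineq1_le].
  apply Req_le. replace (/ cos x ^ 2) with ((sin x * sin x + cos x * cos x) / cos x ^ 2).
  + field. lra.
  + rewrite H. field. lra.
- apply pow2_ge_0.
- apply Rle_trans with (1 + - sin x ^ 2); [apply Req_le; simpl; lra | apply exp_ineq1_le].
Qed.

(** * The diffusive scaling limit of the root-of-unity identity *)

Definition nat_above (r : R) : nat := Z.to_nat (up r).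

Lemma nat_above_spec r : 0 <= r -> r < INR (nat_above r) <= r + 1.
Proof.
intros Hr. unfold nat_above. destruct (archimed r) as [H1 H2].
rewrite INR_IZR_INZ, Z2Nat.id; [lra|]. apply le_IZR. lra.
Qed.

Definition nodd (q : nat) : nat := (2 * q + 3)%nat.

Lemma nodd_INR q : INR (nodd q) = 2 * INR q + 3.
Proof. unfold nodd. rewrite plus_INR, mult_INR. simpl. ring. Qed.

Lemma nodd_pos q : 3 <= INR (nodd q).
Proof. rewrite nodd_INR. generalize (pos_INR q). lra. Qed.

Lemma is_lim_seq_nodd : is_lim_seq (fun q => INR (nodd q)) p_infty.
Proof.
apply (is_lim_seq_le_p_loc INR); [|apply is_lim_seq_INR].
exists 0%nat. intros q _. rewrite nodd_INR. generalize (pos_INR q). lra.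
Qed.

Lemma is_lim_seq_inv_nodd : is_lim_seq (fun q => / INR (nodd q)) 0.
Proof.
replace (Finite 0) with (Rbar_inv p_infty) by reflexivity.
apply is_lim_seq_inv; [apply is_lim_seq_nodd | discriminate].
Qed.

Definition mstep (s : R) (q : nat) : nat := nat_above (s * INR (nodd q) ^ 2).

Lemma mstep_spec s q : 0 < s ->
  s * INR (nodd q) ^ 2 < INR (mstep s q) <= s * INR (nodd q) ^ 2 + 1.
Proof.
intros Hs. apply nat_above_spec. generalize (pow2_ge_0 (INR (nodd q))). nra.
Qed.

Definition mratio (s : R) (q : nat) : R := INR (mstep s q) / INR (nodd q) ^ 2.

Lemma mratio_spec s q : 0 < s -> s < mratio s q <= s + / INR (nodd q).
Proof.
intros Hs. assert (H := mstep_spec s q Hs). assert (Hn := nodd_pos q).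
unfold mratio. split; apply Rmult_lt_reg_r with (INR (nodd q) ^ 2) || apply Rmult_le_reg_r with (INR (nodd q) ^ 2);
  try nra; unfold Rdiv; rewrite Rmult_assoc, Rinv_l, Rmult_1_r by nra; try lra.
replace ((s + / INR (nodd q)) * INR (nodd q) ^ 2) with (s * INR (nodd q) ^ 2 + INR (nodd q)) by (field; lra).
lra.
Qed.

Lemma is_lim_seq_mratio s : 0 < s -> is_lim_seq (mratio s) s.
Proof.
intros Hs. apply (is_lim_seq_le_le (fun _ => s) (mratio s) (fun q => s + / INR (nodd q)) s).
- intros q. assert (H := mratio_spec s q Hs). lra.
- apply is_lim_seq_const.
- replace (Finite s) with (Finite (s + 0)) by (f_equal; ring).
  apply is_lim_seq_plus'; [apply is_lim_seq_const | apply is_lim_seq_inv_nodd].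
Qed.

Lemma is_lim_seq_exp_opp (u : nat -> R) (l : R) : is_lim_seq u l -> is_lim_seq (fun q => exp (- u q)) (exp (- l)).
Proof.
intros H. apply (is_lim_seq_continuous exp (fun q => - u q) (- l)).
- apply derivable_continuous_pt, derivable_pt_exp.
- apply (is_lim_seq_opp u l), H.
Qed.

Lemma ex_series_exp_lin c : 0 < c -> ex_series (fun l => exp (- (c * (INR l + 1)))).
Proof.
intros Hc.
apply (ex_series_ext (fun l => exp (- c) * exp (- c) ^ l)).
- intros l. rewrite exp_pow, <- exp_plus. f_equal. ring.
- apply (ex_series_scal (exp (- c)) (fun l => exp (- c) ^ l)). apply ex_series_geom.
  rewrite Rabs_pos_eq by (apply Rlt_le, exp_pos). rewrite <- exp_0. apply exp_increasing. lra.
Qed.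

Lemma angle_bounds q l : (l <= q)%nat -> 0 < (INR l + 1) * (PI / INR (nodd q)) < PI / 2.
Proof.
intros Hl. apply le_INR in Hl. assert (Hn := nodd_INR q). assert (HP := PI_RGT_0).
assert (Hl0 := pos_INR l). split.
- apply Rmult_lt_0_compat; [lra|]. apply Rdiv_lt_0_compat; lra.
- apply Rmult_lt_reg_r with (INR (nodd q)); [lra|].
  replace ((INR l + 1) * (PI / INR (nodd q)) * INR (nodd q)) with ((INR l + 1) * PI) by (field; lra).
  nra.
Qed.

(** Put x = (l + 1) pi/n. As sin x >= (l + 1)/n and m > s n^2, each term is at most exp(-s (l +
    1)^2), which gives a geometric majorant. For fixed l, m sin^2 x and m tan^2 x have the common
    limit pi^2 s (l + 1)^2, and [cos_pow_bounds] squeezes the term. *)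
Lemma is_lim_seq_cos_sum s : 0 < s ->
  is_lim_seq (fun q => sum_f_R0 (fun l => cos ((INR l + 1) * (PI / INR (nodd q))) ^ (2 * mstep s q)) q)
    (Series (fun l => exp (- (PI ^ 2 * s * (INR l + 1) ^ 2)))).
Proof.
intros Hs.
set (b := fun q l => if Nat.leb l q then cos ((INR l + 1) * (PI / INR (nodd q))) ^ (2 * mstep s q) else 0).
apply (is_lim_seq_ext (fun q => sum_f_R0 (b q) q)).
{ intros q. apply sum_eq. intros l Hl. unfold b. apply Nat.leb_le in Hl. now rewrite Hl. }
apply (tannery b _ (fun l => exp (- (s * (INR l + 1)))) (fun q => q)).
- now apply ex_series_exp_lin.
- intros q l. unfold b. destruct (Nat.leb_spec l q) as [Hl|Hl].
  2:{ rewrite Rabs_R0. apply Rlt_le, exp_pos. }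
  destruct (angle_bounds q l Hl) as [A1 A2].
  assert (Hn := nodd_pos q).
  assert (B := sin_ge_third _ (conj (Rlt_le _ _ A1) (Rlt_le _ _ A2))).
  set (x := (INR l + 1) * (PI / INR (nodd q))) in *.
  assert (Hc : 0 < cos x) by (apply cos_gt_0; lra).
  rewrite Rabs_pos_eq by (apply pow_le; lra).
  eapply Rle_trans; [apply cos_pow_bounds, Hc|]. apply exp_le_compat, Ropp_le_contravar.
  destruct (mstep_spec s q Hs) as [M1 _].
  assert (HP := PI2_3_2). assert (Hl0 := pos_INR l).
  assert (D : (INR l + 1) / INR (nodd q) <= sin x).
  { apply Rle_trans with (2 := B). unfold x.
    replace ((INR l + 1) * (PI / INR (nodd q)) / 3) with ((INR l + 1) / INR (nodd q) * (PI / 3)) by (field; lra).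
    rewrite <- (Rmult_1_r ((INR l + 1) / INR (nodd q))) at 1. apply Rmult_le_compat_l; [|lra].
    apply Rdiv_le_0_compat; lra. }
  apply Rle_trans with (s * INR (nodd q) ^ 2 * ((INR l + 1) / INR (nodd q)) ^ 2).
  + replace (s * INR (nodd q) ^ 2 * ((INR l + 1) / INR (nodd q)) ^ 2) with (s * (INR l + 1) ^ 2) by (field; lra).
    apply Rmult_le_compat_l; [lra|]. nra.
  + apply Rmult_le_compat; [nra | apply pow2_ge_0 | lra |].
    apply pow_incr. split; [|exact D]. apply Rdiv_le_0_compat; lra.
- intros l. set (x := fun q => (INR l + 1) * (PI / INR (nodd q))).
  assert (HP := PI_RGT_0). assert (Hl0 := pos_INR l).
  assert (Hx : is_lim_seq x 0).
  { replace (Finite 0) with (Finite ((INR l + 1) * PI * 0)) by (f_equal; ring).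
    apply (is_lim_seq_ext (fun q => (INR l + 1) * PI * / INR (nodd q))); [intros; unfold x, Rdiv; ring|].
    apply (is_lim_seq_scal_l (fun q => / INR (nodd q)) _ 0), is_lim_seq_inv_nodd. }
  assert (Hsx : is_lim_seq (fun q => sin (x q) / x q) 1).
  { apply (is_lim_comp_seq (fun y => sin y / y) x 0 1 is_lim_sinc_0); [|exact Hx].
    exists l. intros q Hq E. injection E as E. generalize (angle_bounds q l Hq). fold (x q). lra. }
  assert (Hcx : is_lim_seq (fun q => cos (x q)) 1).
  { rewrite <- cos_0. apply (is_lim_seq_continuous cos); [apply continuity_cos | exact Hx]. }
  assert (HS : is_lim_seq (fun q => INR (mstep s q) * sin (x q) ^ 2) (PI ^ 2 * s * (INR l + 1) ^ 2)).
  { apply (is_lim_seq_ext_loc (fun q => mratio s q * ((INR l + 1) * PI * (sin (x q) / x q)) ^ 2)).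
    - exists l. intros q Hq. generalize (angle_bounds q l Hq). fold (x q). intros A.
      assert (Hn := nodd_pos q). unfold mratio, x in *. field. split; [lra|]. split; lra.
    - replace (PI ^ 2 * s * (INR l + 1) ^ 2) with (s * (((INR l + 1) * PI * 1) * (((INR l + 1) * PI * 1) * 1))) by ring.
      apply is_lim_seq_mult'; [now apply is_lim_seq_mratio|].
      assert (H1 : is_lim_seq (fun q => (INR l + 1) * PI * (sin (x q) / x q)) ((INR l + 1) * PI * 1)).
      { apply (is_lim_seq_scal_l _ _ 1), Hsx. }
      apply is_lim_seq_mult'; [exact H1|]. apply is_lim_seq_mult'; [exact H1 | apply is_lim_seq_const]. }
  apply (is_lim_seq_le_le_loc (fun q => exp (- (INR (mstep s q) * (sin (x q) / cos (x q)) ^ 2)))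
     (fun q => b q l) (fun q => exp (- (INR (mstep s q) * sin (x q) ^ 2)))).
  + exists l. intros q Hq. unfold b. assert (Hq' := Hq). apply Nat.leb_le in Hq'. rewrite Hq'.
    generalize (angle_bounds q l Hq). intros A. apply cos_pow_bounds. unfold x. apply cos_gt_0; lra.
  + apply is_lim_seq_exp_opp.
    apply (is_lim_seq_ext_loc (fun q => (INR (mstep s q) * sin (x q) ^ 2) / (cos (x q) * cos (x q)))).
    * exists l. intros q Hq. generalize (angle_bounds q l Hq). fold (x q). intros A.
      assert (0 < cos (x q)) by (apply cos_gt_0; lra). field. lra.
    * replace (PI ^ 2 * s * (INR l + 1) ^ 2) with (PI ^ 2 * s * (INR l + 1) ^ 2 / (1 * 1)) by field.
      apply is_lim_seq_div'; [exact HS | now apply is_lim_seq_mult' | lra].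
  + now apply is_lim_seq_exp_opp.
- intros q l Hl. unfold b. apply Nat.leb_gt in Hl. now rewrite Hl.
Qed.

Lemma is_lim_seq_walk_sum s : 0 < s ->
  is_lim_seq (fun q => sum_f_R0 (fun j => walk (mstep s q) (nodd q * S j) / walk (mstep s q) 0) (mstep s q))
    (Series (fun j => exp (- ((INR j + 1) ^ 2 / s)))).
Proof.
intros Hs.
set (b := fun q j => walk (mstep s q) (nodd q * S j) / walk (mstep s q) 0).
assert (Hm : forall q, (0 < mstep s q)%nat).
{ intros q. destruct (mstep_spec s q Hs) as [H _]. apply INR_lt. simpl.
  apply Rle_lt_trans with (2 := H). generalize (pow2_ge_0 (INR (nodd q))). nra. }
assert (Hr : forall q j, INR (nodd q * S j) = INR (nodd q) * (INR j + 1)).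
{ intros q j. now rewrite mult_INR, S_INR. }
assert (Hup : forall q j, b q j <= exp (- ((INR j + 1) ^ 2 / (mratio s q + (INR j + 1) * / INR (nodd q))))).
{ intros q j. unfold b. assert (W0 := walk_0_pos (mstep s q)).
  apply Rmult_le_reg_l with (walk (mstep s q) 0); [exact W0|].
  replace (walk (mstep s q) 0 * (walk (mstep s q) (nodd q * S j) / walk (mstep s q) 0))
    with (walk (mstep s q) (nodd q * S j)) by (field; lra).
  eapply Rle_trans; [apply walk_upper, Hm|]. apply Req_le. do 3 f_equal. rewrite Hr. unfold mratio.
  assert (Hn := nodd_pos q). destruct (mstep_spec s q Hs) as [M1 _]. assert (Hj := pos_INR j).
  field. repeat split; try lra; nra. }
assert (Hpos : forall q j, 0 <= b q j).
{ intros q j. apply Rdiv_le_0_compat; [apply walk_ge_0 | apply walk_0_pos]. }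
(* Terms with n (j + 1) > m vanish. For the others (j + 1)/n <= m/n^2 <= s + 1, so the denominator
   in [Hup] is at most 2 (s + 1). *)
apply (tannery b _ (fun j => exp (- (/ (2 * (s + 1)) * (INR j + 1)))) (mstep s)).
- apply ex_series_exp_lin. apply Rinv_0_lt_compat. lra.
- intros q j. rewrite Rabs_pos_eq by apply Hpos.
  destruct (Nat.le_gt_cases (nodd q * S j) (mstep s q)) as [H|H].
  + eapply Rle_trans; [apply Hup|]. apply exp_le_compat, Ropp_le_contravar.
    apply le_INR in H. rewrite Hr in H. assert (Hn := nodd_pos q). assert (Hj := pos_INR j).
    destruct (mratio_spec s q Hs) as [R1 R2].
    assert (R3 : (INR j + 1) * / INR (nodd q) <= mratio s q).
    { unfold mratio. apply Rmult_le_reg_r with (INR (nodd q) ^ 2); [nra|].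
      replace ((INR j + 1) * / INR (nodd q) * INR (nodd q) ^ 2) with (INR (nodd q) * (INR j + 1)) by (field; lra).
      replace (INR (mstep s q) / INR (nodd q) ^ 2 * INR (nodd q) ^ 2) with (INR (mstep s q)) by (field; lra).
      exact H. }
    assert (R4 : / INR (nodd q) <= 1).
    { rewrite <- Rinv_1. apply Rinv_le_contravar; lra. }
    assert (R5 : 0 < (INR j + 1) * / INR (nodd q)).
    { apply Rmult_lt_0_compat; [lra|]. apply Rinv_0_lt_compat. lra. }
    rewrite Rmult_comm. unfold Rdiv. apply Rmult_le_compat; [lra | | nra |].
    * apply Rlt_le, Rinv_0_lt_compat. lra.
    * apply Rinv_le_contravar; lra.
  + unfold b. rewrite walk_out by exact H. unfold Rdiv. rewrite Rmult_0_l. apply Rlt_le, exp_pos.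
- intros j. assert (Hj := pos_INR j).
  assert (Hjn : is_lim_seq (fun q => (INR j + 1) * / INR (nodd q)) 0).
  { replace (Finite 0) with (Finite ((INR j + 1) * 0)) by (f_equal; ring).
    apply (is_lim_seq_scal_l (fun q => / INR (nodd q)) _ 0), is_lim_seq_inv_nodd. }
  assert (Hbig : eventually (fun q => INR (nodd q) * (INR j + 1) < INR (mstep s q))).
  { assert (H := is_lim_seq_nodd). apply is_lim_seq_spec in H. destruct (H ((INR j + 1) / s)) as [N HN].
    exists N. intros q Hq. specialize (HN q Hq). destruct (mstep_spec s q Hs) as [M1 _].
    assert (Hn := nodd_pos q).
    apply Rle_lt_trans with (2 := M1).
    apply Rmult_lt_compat_r with (r := s) in HN; [|lra].
    replace ((INR j + 1) / s * s) with (INR j + 1) in HN by (field; lra). nra. }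
  apply (is_lim_seq_le_le_loc
    (fun q => exp (- ((INR j + 1) ^ 2 / (mratio s q - (INR j + 1) * / INR (nodd q)))))
    (fun q => b q j)
    (fun q => exp (- ((INR j + 1) ^ 2 / (mratio s q + (INR j + 1) * / INR (nodd q)))))).
  + destruct Hbig as [N HN]. exists N. intros q Hq. specialize (HN q Hq). split; [|apply Hup].
    unfold b. assert (W0 := walk_0_pos (mstep s q)).
    apply Rmult_le_reg_l with (walk (mstep s q) 0); [exact W0|].
    replace (walk (mstep s q) 0 * (walk (mstep s q) (nodd q * S j) / walk (mstep s q) 0))
      with (walk (mstep s q) (nodd q * S j)) by (field; lra).
    eapply Rle_trans; [|apply walk_lower, INR_lt; rewrite Hr; exact HN].
    apply Req_le. do 3 f_equal. rewrite Hr. unfold mratio.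
    assert (Hn := nodd_pos q). field. repeat split; try lra; nra.
  + apply is_lim_seq_exp_opp, is_lim_seq_div'; [apply is_lim_seq_const| |lra].
    replace (Finite s) with (Finite (s - 0)) by (f_equal; ring). apply is_lim_seq_minus'; [now apply is_lim_seq_mratio | exact Hjn].
  + apply is_lim_seq_exp_opp, is_lim_seq_div'; [apply is_lim_seq_const| |lra].
    replace (Finite s) with (Finite (s + 0)) by (f_equal; ring). apply is_lim_seq_plus'; [now apply is_lim_seq_mratio | exact Hjn].
- intros q l Hl. unfold b. rewrite walk_out; [unfold Rdiv; ring|]. unfold nodd. nia.
Qed.

(** A Wallis-type limit by monotonicity: m (walk m 0)^2 increases, while (m + 1/2) (walk m 0)^2
    decreases and so stays bounded. The value of the limit is fixed later by the theta
    transformation itself. *)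
Lemma is_lim_seq_walk_0 : exists c, 0 < c /\ is_lim_seq (fun m => sqrt (INR m) * walk m 0) c.
Proof.
assert (Hincr : forall m, sqrt (INR m) * walk m 0 <= sqrt (INR (S m)) * walk (S m) 0).
{ intros m. assert (Hm := pos_INR m). assert (W := walk_0_pos m).
  apply Rsqr_incr_0_var.
  2:{ apply Rmult_le_pos; [apply sqrt_pos | apply walk_ge_0]. }
  rewrite !Rsqr_mult, !Rsqr_sqrt by apply pos_INR. rewrite walk_S_0, S_INR. unfold Rsqr.
  replace ((INR m + 1) * (walk m 0 * ((2 * INR m + 1) / (2 * INR m + 2)) * (walk m 0 * ((2 * INR m + 1) / (2 * INR m + 2)))))
    with ((INR m + / (4 * (INR m + 1))) * (walk m 0 * walk m 0)) by (field; lra).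
  apply Rmult_le_compat_r; [nra|].
  assert (0 < / (4 * (INR m + 1))) by (apply Rinv_0_lt_compat; lra). lra. }
destruct (ex_finite_lim_seq_incr (fun m => sqrt (INR m) * walk m 0) 1 Hincr) as [c Hc].
- intros m.
  assert (B : (INR m + / 2) * walk m 0 ^ 2 <= 1).
  { induction m as [|m IH]; [simpl; lra|]. assert (Hm := pos_INR m).
    rewrite walk_S_0, S_INR. apply Rle_trans with (2 := IH).
    replace ((INR m + 1 + / 2) * (walk m 0 * ((2 * INR m + 1) / (2 * INR m + 2))) ^ 2)
      with ((INR m + / 2 - (2 * INR m + 1) / (8 * (INR m + 1) ^ 2)) * walk m 0 ^ 2) by (field; lra).
    apply Rmult_le_compat_r; [apply pow2_ge_0|].
    assert (0 < (2 * INR m + 1) / (8 * (INR m + 1) ^ 2)) by (apply Rdiv_lt_0_compat; nra). lra. }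
  assert (Hm := pos_INR m).
  apply Rsqr_incr_0_var; [|lra].
  rewrite Rsqr_mult, Rsqr_sqrt by apply pos_INR. unfold Rsqr.
  generalize (pow2_ge_0 (walk m 0)). simpl in *. nra.
- exists c. split; [|exact Hc].
  apply Rlt_le_trans with (sqrt (INR 1) * walk 1 0); [simpl; rewrite sqrt_1; lra|].
  apply (is_lim_seq_incr_compare (fun m => sqrt (INR m) * walk m 0)); [exact Hc | exact Hincr].
Qed.

(** * The theta transformation and half-integral Gamma values *)

(** Both sides of [polya_identity] are passed to the limit; the prefactor is n [walk m 0] = sqrt m
    [walk m 0] / sqrt(m/n^2), which tends to c/sqrt s. *)
Lemma theta_scaled : exists c, 0 < c /\ forall s, 0 < s ->
  1 + 2 * Series (fun l => exp (- (PI ^ 2 * s * (INR l + 1) ^ 2))) =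
  c / sqrt s * (1 + 2 * Series (fun j => exp (- ((INR j + 1) ^ 2 / s)))).
Proof.
destruct is_lim_seq_walk_0 as [c [Hc Hw]]. exists c. split; [exact Hc|]. intros s Hs.
assert (Hsq : 0 < sqrt s) by now apply sqrt_lt_R0.
assert (L1 : is_lim_seq (fun q => 1 + 2 * sum_f_R0 (fun l =>
    cos ((INR l + 1) * (PI / INR (nodd q))) ^ (2 * mstep s q)) q)
    (1 + 2 * Series (fun l => exp (- (PI ^ 2 * s * (INR l + 1) ^ 2))))).
{ apply is_lim_seq_plus'; [apply is_lim_seq_const|].
  apply is_lim_seq_mult'; [apply is_lim_seq_const | now apply is_lim_seq_cos_sum]. }
assert (Hsub : is_lim_seq (fun q => sqrt (INR (mstep s q)) * walk (mstep s q) 0) c).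
{ apply (is_lim_seq_subseq (fun m => sqrt (INR m) * walk m 0) c (mstep s)); [|exact Hw].
  intros P [N HN]. assert (H := is_lim_seq_nodd). apply is_lim_seq_spec in H.
  destruct (H (INR N / s)) as [Q HQ]. exists Q. intros q Hq. apply HN.
  specialize (HQ q Hq). apply INR_le. destruct (mstep_spec s q Hs) as [M _].
  assert (Hn := nodd_pos q).
  apply Rmult_lt_compat_r with (r := s) in HQ; [|lra].
  replace (INR N / s * s) with (INR N) in HQ by (field; lra).
  assert (0 <= s * INR (nodd q) * (INR (nodd q) - 1)) by (repeat apply Rmult_le_pos; lra). lra. }
assert (Hms : is_lim_seq (fun q => sqrt (mratio s q)) (sqrt s)).
{ apply (is_lim_seq_continuous sqrt); [apply continuity_pt_sqrt; lra | now apply is_lim_seq_mratio]. }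
assert (L2 : is_lim_seq (fun q => sqrt (INR (mstep s q)) * walk (mstep s q) 0 / sqrt (mratio s q) *
    (1 + 2 * sum_f_R0 (fun j => walk (mstep s q) (nodd q * S j) / walk (mstep s q) 0) (mstep s q)))
    (c / sqrt s * (1 + 2 * Series (fun j => exp (- ((INR j + 1) ^ 2 / s)))))).
{ apply is_lim_seq_mult'.
  - apply is_lim_seq_div'; [exact Hsub | exact Hms | lra].
  - apply is_lim_seq_plus'; [apply is_lim_seq_const|].
    apply is_lim_seq_mult'; [apply is_lim_seq_const | now apply is_lim_seq_walk_sum]. }
assert (E : forall q, 1 + 2 * sum_f_R0 (fun l =>
    cos ((INR l + 1) * (PI / INR (nodd q))) ^ (2 * mstep s q)) q =
  sqrt (INR (mstep s q)) * walk (mstep s q) 0 / sqrt (mratio s q) *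
    (1 + 2 * sum_f_R0 (fun j => walk (mstep s q) (nodd q * S j) / walk (mstep s q) 0) (mstep s q))).
{ intros q. assert (P := polya_identity (mstep s q) q). cbv zeta in P. fold (nodd q) in P. rewrite P.
  assert (Hn := nodd_pos q). destruct (mstep_spec s q Hs) as [M _].
  assert (Hm : 0 < INR (mstep s q)) by nra.
  assert (W := walk_0_pos (mstep s q)).
  assert (Hsm : 0 < sqrt (INR (mstep s q))) by now apply sqrt_lt_R0.
  unfold mratio. rewrite sqrt_div_alt by nra. rewrite sqrt_pow2 by lra.
  rewrite (sum_eq (fun j => _ / _) (fun j => walk (mstep s q) (nodd q * S j) * / walk (mstep s q) 0))
    by (intros; reflexivity).
  rewrite <- scal_sum. field. lra. }
apply (is_lim_seq_ext _ _ _ E) in L1.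
apply is_lim_seq_unique in L1. apply is_lim_seq_unique in L2. rewrite L1 in L2.
now injection L2.
Qed.

Definition theta_sum (y : R) : R := Series (fun l => exp (- (PI * (INR l + 1) ^ 2 * y))).

Lemma ex_series_theta y : 0 < y -> ex_series (fun l => exp (- (PI * (INR l + 1) ^ 2 * y))).
Proof.
intros Hy. assert (HP := PI_RGT_0).
apply (@ex_series_le R_AbsRing R_CompleteNormedModule _ (fun l => exp (- (PI * y * (INR l + 1))))).
- intros l. unfold norm; simpl; unfold abs; simpl. rewrite Rabs_pos_eq by (apply Rlt_le, exp_pos).
  apply exp_le_compat, Ropp_le_contravar.
  assert (H := pos_INR l).
  replace (PI * ((INR l + 1) * ((INR l + 1) * 1)) * y) with (PI * y * ((INR l + 1) * (INR l + 1))) by ring.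
  apply Rmult_le_compat_l; nra.
- apply ex_series_exp_lin. nra.
Qed.

Lemma theta_jacobi y : 0 < y -> 1 + 2 * theta_sum y = / sqrt y * (1 + 2 * theta_sum (/ y)).
Proof.
assert (HP := PI_RGT_0). assert (HsP : 0 < sqrt PI) by now apply sqrt_lt_R0.
destruct theta_scaled as [c [Hc H]].
(* The choice s = z/pi turns the exponents pi^2 s (l + 1)^2 and (j + 1)^2/s into pi z (l + 1)^2 and
   pi (j + 1)^2/z. *)
assert (K : forall z, 0 < z -> 1 + 2 * theta_sum z = c * sqrt PI / sqrt z * (1 + 2 * theta_sum (/ z))).
{ intros z Hz. assert (Hsz : 0 < sqrt z) by now apply sqrt_lt_R0.
  assert (Hzp : 0 < z / PI) by (apply Rdiv_lt_0_compat; lra).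
  specialize (H (z / PI) Hzp). rewrite sqrt_div_alt in H by lra.
  replace (c * sqrt PI / sqrt z) with (c / (sqrt z / sqrt PI)) by (field; lra).
  unfold theta_sum. etransitivity; [etransitivity; [|exact H]|].
  - do 2 f_equal. apply Series_ext. intros l. do 2 f_equal. field. lra.
  - do 3 f_equal. apply Series_ext. intros l. do 2 f_equal. field. lra. }
(* The unknown constant is read off at the fixed point of the transformation. *)
assert (Ec : c * sqrt PI = 1).
{ assert (K1 := K 1 Rlt_0_1). rewrite sqrt_1, Rinv_1, Rdiv_1_r in K1.
  assert (0 <= theta_sum 1).
  { unfold theta_sum. replace 0 with (Series (fun _ => 0)) by (exact (Series_finite (fun _ => 0) 0 (fun _ _ => eq_refl))).
    apply Series_le; [|apply ex_series_theta; lra].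
    intros l. split; [lra | apply Rlt_le, exp_pos]. }
  nra. }
intros Hy. rewrite (K y Hy), Ec. field. apply Rgt_not_eq. now apply sqrt_lt_R0.
Qed.

Lemma gauss_moment_rec j l : is_RInt_inf (gmom 1 0 j) 0 l ->
  is_RInt_inf (gmom 1 0 (S (S j))) 0 ((INR j + 1) / 2 * l).
Proof.
intros Hl.
assert (H : is_RInt_inf (fun x => (INR j + 1) * gmom 1 0 j x - 2 * gmom 1 0 (S (S j)) x) 0
    (0 - gmom 1 0 (S j) 0)).
{ apply is_RInt_inf_derive.
  - intros x _. unfold gmom. auto_derive; [exact I|].
    change (match j with 0%nat => 1 | S _ => INR j + 1 end) with (INR (S j)).
    rewrite S_INR. simpl pow. ring.
  - intros x _. unfold gmom. continuous_auto.
  - apply is_lim_gmom; lra. }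
assert (Q : gmom 1 0 (S j) 0 = 0) by (unfold gmom; simpl; ring).
rewrite Q in H.
eapply is_RInt_inf_ext;
  [|replace ((INR j + 1) / 2 * l) with (- / 2 * (0 - 0) + (INR j + 1) / 2 * l) by field;
    apply is_RInt_inf_plus; apply is_RInt_inf_scal; eassumption].
intros x _. simpl. field.
Qed.

Lemma gauss_moment_odd m : is_RInt_inf (gmom 1 0 (2 * m + 1)) 0 (INR (fact m) / 2).
Proof.
induction m as [|m IH].
- replace (INR (fact 0) / 2) with (- / 2 * 0 - - / 2 * gmom 1 0 0 0).
  2:{ unfold gmom. replace (- (1 * 0 ^ 2 + 0 * 0)) with 0 by ring. rewrite exp_0. simpl. field. }
  apply (is_RInt_inf_derive _ (fun x => - / 2 * gmom 1 0 0 x)).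
  + intros x _. unfold gmom. auto_derive; [exact I|]. simpl. field.
  + intros; apply continuous_gmom.
  + apply (is_lim_scal_l (gmom 1 0 0) _ p_infty 0). apply is_lim_gmom; lra.
- replace (2 * S m + 1)%nat with (S (S (2 * m + 1))) by lia.
  replace (INR (fact (S m)) / 2) with ((INR (2 * m + 1) + 1) / 2 * (INR (fact m) / 2)).
  + now apply gauss_moment_rec.
  + rewrite fact_simpl, mult_INR, plus_INR, mult_INR, (S_INR m). simpl (INR 2). simpl (INR 1). field.
Qed.

Lemma gauss_moment_even m : is_RInt_inf (gmom 1 0 (2 * m + 2)) 0 (sqrt PI / 4 * poch (3 / 2) m).
Proof.
induction m as [|m IH].
- replace (sqrt PI / 4 * poch (3 / 2) 0) with ((INR 0 + 1) / 2 * (sqrt PI / 2)) by (simpl; field).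
  apply gauss_moment_rec. split.
  + intros b _. apply (@ex_RInt_continuous R_CompleteNormedModule). intros; apply continuous_gmom.
  + apply (is_lim_ext gauss_prim); [|apply is_lim_gauss_prim].
    intros b. unfold gauss_prim. apply RInt_ext. intros x _. unfold gmom. simpl. rewrite Rmult_1_l. f_equal. ring.
- replace (2 * S m + 2)%nat with (S (S (2 * m + 2))) by lia.
  replace (sqrt PI / 4 * poch (3 / 2) (S m)) with ((INR (2 * m + 2) + 1) / 2 * (sqrt PI / 4 * poch (3 / 2) m)).
  + now apply gauss_moment_rec.
  + rewrite plus_INR, mult_INR. simpl. field.
Qed.

(** The substitution t = x^2 turns t^(s-1) dt into 2 x^j dx. For j >= 1 the exponent s - 1 is
    non-negative, so 0 is not a singular endpoint. *)
Lemma Gamma_gauss j s l : (0 < j)%nat -> s = (INR j + 1) / 2 ->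
  is_RInt_inf (gmom 1 0 j) 0 l -> Gamma s = 2 * l.
Proof.
intros Hj Hs [_ Hl]. unfold Gamma. apply is_RInt_inf_RInt_gen.
(* This version is continuous on the whole line and agrees with the [Rpower] integrand for t > 0. *)
set (f := fun t => sqrt t ^ pred j * exp (- t)).
assert (Hcs : forall x, continuous f x).
{ intros x. apply (continuous_mult (fun t => sqrt t ^ pred j) (fun t => exp (- t))).
  - apply (continuous_comp sqrt (fun z => z ^ pred j)); [apply continuous_sqrt | continuous_auto].
  - continuous_auto. }
apply (is_RInt_inf_ext f).
{ intros t Ht. unfold f. f_equal. rewrite <- Rpower_pow by now apply sqrt_lt_R0.
  rewrite <- Rpower_sqrt by exact Ht. rewrite Rpower_mult. f_equal.
  destruct j as [|j]; [lia|]. rewrite Hs, S_INR. simpl pred. field. }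
apply (is_RInt_inf_lim f (fun X => 2 * RInt (gmom 1 0 j) 0 (sqrt X))).
- intros X HX.
  assert (C := is_RInt_comp f (fun x => x ^ 2) (fun x => 2 * x) 0 (sqrt X)).
  assert (E : RInt f 0 X = 2 * RInt (gmom 1 0 j) 0 (sqrt X)).
  { replace X with (sqrt X ^ 2) at 1 by (simpl; rewrite Rmult_1_r; now apply sqrt_sqrt).
    replace 0 with (0 ^ 2) at 1 by ring.
    symmetry. etransitivity; [|apply is_RInt_unique, C].
    - transitivity (RInt (fun x => scal 2 (gmom 1 0 j x)) 0 (sqrt X)).
      + symmetry. apply (RInt_scal (gmom 1 0 j)).
        apply (@ex_RInt_continuous R_CompleteNormedModule). intros; apply continuous_gmom.
      + apply RInt_ext. intros x. rewrite Rmin_left, Rmax_right by apply sqrt_pos. intros Hx.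
        unfold f, gmom, scal; simpl; unfold mult; simpl.
        replace (x * (x * 1)) with (x * x) by ring. rewrite sqrt_square by lra.
        replace (1 * (x * x) + 0 * x) with (x * x) by ring.
        destruct j as [|j]; [lia|]. simpl. ring.
    - intros x _. apply Hcs.
    - intros x _. split; [|continuous_auto]. auto_derive; [exact I | ring]. }
  rewrite <- E. apply (@RInt_correct R_CompleteNormedModule).
  apply (@ex_RInt_continuous R_CompleteNormedModule). intros; apply Hcs.
- apply (is_lim_scal_l (fun X => RInt (gmom 1 0 j) 0 (sqrt X)) 2 p_infty l).
  apply (is_lim_comp (RInt (gmom 1 0 j) 0) sqrt p_infty l p_infty Hl filterlim_sqrt_p).
  exists 0. discriminate.
Qed.

(** With m = 2k + 1 the values are Gamma(m + 1) = m! and Gamma(m + 3/2) = (sqrt pi/2) (3/2)_m, so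
    [wint_poch] identifies the quotient as 2 [wint m] / sqrt pi. *)
Lemma Gamma_ratio k :
  sqrt (PI / 2) * (Gamma (2 * INR k + 2) / Gamma (2 * INR k + 5 / 2)) = sqrt 2 * wint (2 * k + 1).
Proof.
set (m := (2 * k + 1)%nat).
assert (Hm : INR m = 2 * INR k + 1) by (unfold m; rewrite plus_INR, mult_INR; reflexivity).
rewrite (Gamma_gauss (2 * m + 1) (2 * INR k + 2) _ ltac:(lia)
  ltac:(rewrite plus_INR, mult_INR, Hm; simpl; field) (gauss_moment_odd m)).
rewrite (Gamma_gauss (2 * m + 2) (2 * INR k + 5 / 2) _ ltac:(lia)
  ltac:(rewrite plus_INR, mult_INR, Hm; simpl; field) (gauss_moment_even m)).
rewrite <- (wint_poch m), sqrt_div_alt by lra.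
assert (0 < poch (3 / 2) m) by (apply poch_pos; lra).
assert (0 < sqrt PI) by apply sqrt_lt_R0, PI_RGT_0.
assert (H2 : 0 < sqrt 2) by (apply sqrt_lt_R0; lra).
transitivity (2 / sqrt 2 * wint m); [field; lra|].
rewrite <- (sqrt_sqrt 2) at 1 by lra. field. lra.
Qed.

(** * Inversion and term-by-term integration *)

Lemma is_RInt_inf_from f a b l :
  a <= b -> is_RInt_inf f a l -> is_RInt_inf f b (l - RInt f a b).
Proof.
intros Hab [Hex Hl].
assert (Hb : forall c, b <= c -> ex_RInt f b c).
{ intros c Hc. apply (ex_RInt_Chasles_2 f a b c); [lra | apply Hex; lra]. }
split; [exact Hb|].
apply (is_lim_ext_loc (fun c => RInt f a c - RInt f a b)).
- exists b. intros c Hc. rewrite <- (RInt_Chasles f a b c).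
  + unfold plus; simpl. ring.
  + apply Hex. lra.
  + apply Hb. lra.
- apply is_lim_minus'; [exact Hl | apply is_lim_const].
Qed.

(** The substitution x = 1/t covers [1/X, 1]; the missing piece over [0, 1/X] is at most M/X, where
    M bounds |f| on [0,1]. *)
Lemma is_RInt_inf_inversion (f : R -> R) :
  (forall x, 0 <= x <= 1 -> continuous f x) ->
  is_RInt_inf (fun t => / t ^ 2 * f (/ t)) 1 (RInt f 0 1).
Proof.
intros Hf.
apply (is_RInt_inf_lim _ (fun X => RInt f 0 1 - RInt f 0 (/ X))).
- intros X HX.
  assert (HX1 : 0 < / X <= 1).
  { split; [apply Rinv_0_lt_compat; lra|]. rewrite <- Rinv_1. apply Rinv_le_contravar; lra. }
  assert (C : is_RInt (fun t => scal (- / t ^ 2) (f (/ t))) 1 X (RInt f (/ 1) (/ X))).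
  { apply (is_RInt_comp f Rinv (fun t => - / t ^ 2)); intros t; rewrite Rmin_left, Rmax_right by lra;
    intros Ht.
    - apply Hf. split; [apply Rlt_le, Rinv_0_lt_compat; lra|].
      rewrite <- Rinv_1. apply Rinv_le_contravar; lra.
    - assert (t * (t * 1) <> 0) by nra. split; [auto_derive; [lra | field; lra]|].
      apply (@ex_derive_continuous R_AbsRing R_NormedModule). auto_derive. assumption. }
  rewrite Rinv_1 in C.
  apply (is_RInt_ext (fun t => scal (-1) (scal (- / t ^ 2) (f (/ t))))).
  { intros t _. unfold scal; simpl; unfold mult; simpl. ring. }
  replace (RInt f 0 1 - RInt f 0 (/ X)) with (scal (-1) (RInt f 1 (/ X))).
  + now apply (is_RInt_scal (fun t => scal (- / t ^ 2) (f (/ t)))).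
  + assert (E : RInt f 0 (/ X) + RInt f (/ X) 1 = RInt f 0 1).
    { apply (RInt_Chasles f 0 (/ X) 1); apply ex_RInt_cont; try lra; intros; apply Hf; lra. }
    rewrite <- (opp_RInt_swap f (/ X) 1) by (apply ex_RInt_cont; [intros; apply Hf; lra | lra]).
    rewrite <- E. unfold scal, opp; simpl; unfold mult; simpl. ring.
- replace (Finite (RInt f 0 1)) with (Finite (RInt f 0 1 - 0)) by (f_equal; ring).
  apply is_lim_minus'; [apply is_lim_const|].
  assert (Hb : exists M, forall x, 0 <= x <= 1 -> Rabs (f x) <= M).
  { destruct (continuity_ab_maj (fun x => Rabs (f x)) 0 1) as [Mx [HM _]]; [lra| |].
    - intros c Hc. apply continuity_pt_filterlim. apply continuous_Rabs_comp. now apply Hf.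
    - now exists (Rabs (f Mx)). }
  destruct Hb as [M HM].
  assert (Li : is_lim (fun X => M * / X) p_infty 0).
  { replace (Finite 0) with (Rbar_mult M 0) by (simpl; f_equal; ring).
    apply (is_lim_scal_l Rinv). replace (Finite 0) with (Rbar_inv p_infty) by reflexivity.
    apply is_lim_inv; [apply is_lim_id | discriminate]. }
  assert (B : forall X, 1 < X -> Rabs (RInt f 0 (/ X)) <= M * / X).
  { intros X HX.
    assert (HX1 : 0 < / X <= 1).
    { split; [apply Rinv_0_lt_compat; lra|]. rewrite <- Rinv_1. apply Rinv_le_contravar; lra. }
    replace (M * / X) with ((/ X - 0) * M) by ring.
    apply abs_RInt_le_const; [lra | |].
    - apply ex_RInt_cont; [intros; apply Hf; lra | lra].
    - intros; apply HM; lra. }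
  apply (is_lim_le_le_loc (fun X => - (M * / X)) (fun X => M * / X)).
  + exists 1. intros X HX. apply Rabs_le_between, B, HX.
  + replace (Finite 0) with (Rbar_opp 0) by (simpl; f_equal; ring). now apply is_lim_opp.
  + exact Li.
Qed.

(** [filterlim_RInt] asks for uniform convergence on the whole line, hence [cut], which sets all
    functions to 0 outside [a,b]. *)
Lemma ex_RInt_unif_lim (f : nat -> R -> R) (g : R -> R) (e : nat -> R) a b : a <= b ->
  (forall n, ex_RInt (f n) a b) -> (forall n x, a <= x <= b -> Rabs (g x - f n x) <= e n) ->
  is_lim_seq e 0 -> ex_RInt g a b.
Proof.
intros Hab Hf He Hl.
set (cut := fun (h : R -> R) x => if Rle_dec a x then if Rle_dec x b then h x else 0 else 0).
assert (Hcut : forall h x, a <= x <= b -> cut h x = h x).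
{ intros h x Hx. unfold cut. destruct Rle_dec; [|lra]. destruct Rle_dec; [reflexivity|lra]. }
destruct (filterlim_RInt (fun n => cut (f n)) a b eventually eventually_filter (cut g)
  (fun n => RInt (f n) a b)) as [I [_ HI]].
- intros n. apply (is_RInt_ext (f n)).
  + intros x. rewrite Rmin_left, Rmax_right by lra. intros Hx. rewrite Hcut; [reflexivity|lra].
  + apply (@RInt_correct R_CompleteNormedModule), Hf.
- apply filterlim_locally. intros eps. apply is_lim_seq_spec in Hl. destruct (Hl eps) as [N HN].
  exists N. intros n Hn x. specialize (HN n Hn). rewrite Rminus_0_r in HN.
  assert (He0 : e n < eps) by (generalize (Rle_abs (e n)); lra).
  unfold cut. destruct (Rle_dec a x) as [H1|H1]; [destruct (Rle_dec x b) as [H2|H2]|];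
    try apply ball_center.
  unfold ball; simpl; unfold AbsRing_ball, abs, minus, plus, opp; simpl.
  replace (f n x + - g x) with (- (g x - f n x)) by ring. rewrite Rabs_Ropp.
  eapply Rle_lt_trans; [apply He; lra | exact He0].
- exists I. apply (is_RInt_ext (cut g)); [|exact HI].
  intros x. rewrite Rmin_left, Rmax_right by lra. intros Hx. apply Hcut. lra.
Qed.

(** With a majorant in product form the remainder is at most (tail of [u]) times [G]. Boundedness of
    [G] gives uniform convergence, hence local integrability of the sum; the finite integral of [G]
    controls the error in mean. *)
Lemma is_RInt_inf_series (f : nat -> R -> R) (G : R -> R) (u I : nat -> R) (a g M : R) :
  (forall n, is_RInt_inf (f n) a (I n)) ->
  (forall n x, a <= x -> Rabs (f n x) <= u n * G x) -> (forall x, a <= x -> 0 <= G x <= M) ->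
  ex_series u -> is_RInt_inf G a g ->
  exists l : R, is_lim_seq (sum_f_R0 I) l /\ is_RInt_inf (fun x => Series (fun n => f n x)) a l.
Proof.
intros Hf Hb HG Hu Hg.
assert (Hlim : forall c, is_lim_seq (fun N => (Series u - sum_f_R0 u N) * c) 0).
{ intros c. replace (Finite 0) with (Finite ((Series u - Series u) * c)) by (f_equal; ring).
  apply is_lim_seq_mult'; [|apply is_lim_seq_const].
  apply is_lim_seq_minus'; [apply is_lim_seq_const | now apply is_lim_seq_sum_f_R0]. }
assert (T : forall N x, a <= x ->
  Rabs (Series (fun n => f n x) - sum_f_R0 (fun n => f n x) N) <= (Series u - sum_f_R0 u N) * G x).
{ intros N x Hx. eapply Rle_trans; [apply (Series_tail_bound _ (fun n => u n * G x))|].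
  - now apply (ex_series_scal_r (G x) u).
  - intros l. now apply Hb.
  - rewrite Series_scal_r.
    replace (sum_f_R0 (fun n => u n * G x) N) with (sum_f_R0 u N * G x)
      by (rewrite Rmult_comm; apply scal_sum).
    apply Req_le. ring. }
assert (HS : forall N, is_RInt_inf (fun x => sum_f_R0 (fun n => f n x) N) a (sum_f_R0 I N)).
{ intros N. apply is_RInt_inf_sum. intros j _. apply Hf. }
apply (is_RInt_inf_approx _ a (fun N x => sum_f_R0 (fun n => f n x) N)
  (fun N x => (Series u - sum_f_R0 u N) * G x) _ (fun N => (Series u - sum_f_R0 u N) * g)).
- intros b Hab.
  apply (ex_RInt_unif_lim (fun N x => sum_f_R0 (fun n => f n x) N) _
    (fun N => Rabs ((Series u - sum_f_R0 u N) * M)) a b Hab).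
  + intros N. now apply (HS N).
  + intros N x Hx. eapply Rle_trans; [apply T; lra|].
    rewrite Rabs_mult. eapply Rle_trans; [apply Rle_abs|]. rewrite Rabs_mult.
    apply Rmult_le_compat_l; [apply Rabs_pos|]. destruct (HG x) as [G1 G2]; [lra|].
    rewrite !Rabs_pos_eq; lra.
  + replace (Finite 0) with (Rbar_abs 0) by (simpl; f_equal; apply Rabs_R0).
    apply (is_lim_seq_abs _ 0), Hlim.
- exact HS.
- intros N. now apply is_RInt_inf_scal.
- intros N x Hx. apply T. lra.
- apply Hlim.
Qed.

(** Comparison with a telescoping sum: 1/y^3 <= 2/x - 2/y when y^2 = x^2 + 1 and 0 < x < y. *)
Lemma ex_series_three_halves : ex_series (fun n => / ((INR n + 1) * sqrt (INR n + 1))).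
Proof.
assert (P : forall n, 0 < (INR n + 1) * sqrt (INR n + 1)).
{ intros n. generalize (pos_INR n). intros. apply Rmult_lt_0_compat; [lra|]. apply sqrt_lt_R0. lra. }
assert (B : forall n, sum_f_R0 (fun n => / ((INR n + 1) * sqrt (INR n + 1))) n <= 3 - 2 / sqrt (INR n + 1)).
{ induction n as [|n IH].
  - simpl. rewrite Rplus_0_l, sqrt_1. lra.
  - rewrite tech5, S_INR. assert (Hn := pos_INR n).
    set (x := sqrt (INR n + 1)) in *. set (y := sqrt (INR n + 1 + 1)).
    assert (Hx : 0 < x) by (apply sqrt_lt_R0; lra).
    assert (Hxx : x * x = INR n + 1) by (apply sqrt_sqrt; lra).
    assert (Hyy : y * y = INR n + 1 + 1) by (apply sqrt_sqrt; lra).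
    assert (Hxy : x < y) by (apply sqrt_lt_1; lra).
    rewrite <- Hyy.
    assert (D : / (y * y * y) <= 2 / x - 2 / y); [|lra].
    replace (2 / x - 2 / y) with (2 * (y * y - x * x) / (x * y * (x + y))) by (field; lra).
    replace (y * y - x * x) with 1 by lra.
    apply Rmult_le_reg_r with (y * y * y * (x * y * (x + y))).
    { repeat apply Rmult_lt_0_compat; lra. }
    replace (/ (y * y * y) * (y * y * y * (x * y * (x + y)))) with (y * (x * (x + y))) by (field; lra).
    replace (2 * 1 / (x * y * (x + y)) * (y * y * y * (x * y * (x + y)))) with (y * (2 * (y * y))) by (field; lra).
    apply Rmult_le_compat_l; nra. }
destruct (ex_finite_lim_seq_incr (sum_n (fun n => / ((INR n + 1) * sqrt (INR n + 1)))) 3) as [l Hl].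
- intros n. rewrite sum_Sn. unfold plus; simpl plus.
  generalize (Rinv_0_lt_compat _ (P (S n))). simpl. lra.
- intros n. rewrite sum_n_Reals. eapply Rle_trans; [apply B|].
  assert (0 < 2 / sqrt (INR n + 1)); [|lra].
  generalize (pos_INR n). intros. apply Rdiv_lt_0_compat; [lra|]. apply sqrt_lt_R0. lra.
- now exists l.
Qed.

(** * Summing the Laplace transforms *)

(** With z = p x^2, each term contains z^j exp(-z), which is at most j!. *)
Lemma hyp1F1_gauss_bound m p : 0 < p ->
  exists K, forall x, Rabs (exp (- (p * x ^ 2)) * hyp1F1_neg m (3 / 2) (2 * p * x ^ 2)) <= K.
Proof.
intros Hp.
set (co := fun j => poch (- INR m) j / poch (3 / 2) j / INR (fact j)).
exists (sum_f_R0 (fun j => Rabs (co j) * (2 ^ j * INR (fact j))) m). intros x.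
unfold hyp1F1_neg. rewrite scal_sum.
eapply Rle_trans; [apply Rsum_abs|]. apply sum_Rle. intros j _.
assert (Hz : 0 <= p * x ^ 2) by (apply Rmult_le_pos; [lra | apply pow2_ge_0]).
replace (poch (- INR m) j / poch (3 / 2) j * (2 * p * x ^ 2) ^ j / INR (fact j) * exp (- (p * x ^ 2)))
  with (co j * (2 ^ j * ((p * x ^ 2) ^ j * exp (- (p * x ^ 2))))).
2:{ unfold co. rewrite (Rmult_assoc 2 p), (Rpow_mult_distr 2). unfold Rdiv. ring. }
rewrite Rabs_mult. apply Rmult_le_compat_l; [apply Rabs_pos|].
assert (0 < 2 ^ j) by (apply pow_lt; lra).
assert (Hw := pow_le_exp j _ Hz). assert (0 <= (p * x ^ 2) ^ j) by now apply pow_le.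
assert (He := exp_pos (- (p * x ^ 2))).
assert (Hee : exp (p * x ^ 2) * exp (- (p * x ^ 2)) = 1) by (rewrite <- exp_plus, Rplus_opp_r; apply exp_0).
rewrite Rabs_pos_eq by (repeat apply Rmult_le_pos; lra).
apply Rmult_le_compat_l; [lra|].
apply Rle_trans with (INR (fact j) * exp (p * x ^ 2) * exp (- (p * x ^ 2))).
- apply Rmult_le_compat_r; lra.
- rewrite Rmult_assoc, Hee. lra.
Qed.

Lemma continuous_hyp1F1 m p x : continuous (fun x => hyp1F1_neg m (3 / 2) (2 * p * x ^ 2)) x.
Proof.
unfold hyp1F1_neg.
assert (H : forall n, continuous (fun x => sum_f_R0 (fun j =>
  poch (- INR m) j / poch (3 / 2) j * (2 * p * x ^ 2) ^ j / INR (fact j)) n) x); [|apply H].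
assert (T : forall j, continuous (fun x =>
  poch (- INR m) j / poch (3 / 2) j * (2 * p * x ^ 2) ^ j / INR (fact j)) x).
{ intros j. apply (continuous_ext (fun x =>
    poch (- INR m) j / poch (3 / 2) j / INR (fact j) * (2 * p * x ^ 2) ^ j)).
  - intros y. match goal with |- ?l = ?r => change (@eq R l r) end. unfold Rdiv. ring.
  - continuous_auto. }
induction n as [|n IH]; [apply T|].
apply (continuous_plus (fun x => sum_f_R0 _ n)); [exact IH | apply T].
Qed.

(* The quotient [(exp (c x) - 1) / x] with its removable singularity filled in. *)
Definition expm1_quot (c x : R) : R := if Req_dec_T x 0 then c else (exp (c * x) - 1) / x.

Lemma expm1_quot_pos c x : 0 < c -> 0 <= x -> 0 < expm1_quot c x.
Proof.
intros Hc Hx. unfold expm1_quot. destruct Req_dec_T as [|H]; [exact Hc|].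
apply Rdiv_lt_0_compat; [|lra]. assert (1 < exp (c * x)); [|lra].
rewrite <- exp_0. apply exp_increasing. nra.
Qed.

Lemma continuous_expm1_quot c x : 0 <= x -> continuous (expm1_quot c) x.
Proof.
intros Hx. destruct (Req_dec_T x 0) as [->|H].
- assert (D : is_derive (fun x => exp (c * x)) 0 c).
  { auto_derive; [exact I|]. rewrite Rmult_0_r, exp_0. ring. }
  apply is_derive_Reals in D.
  apply filterlim_locally. intros eps. destruct (D eps (cond_pos eps)) as [d Hd].
  exists d. intros y Hy. unfold expm1_quot at 1. destruct (Req_dec_T 0 0) as [_|]; [|lra].
  unfold expm1_quot. destruct (Req_dec_T y 0) as [E|E]; [apply ball_center|].
  specialize (Hd y E). rewrite Rplus_0_l, Rmult_0_r, exp_0 in Hd.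
  apply Hd. unfold ball in Hy; simpl in Hy; unfold AbsRing_ball, abs, minus, plus, opp in Hy; simpl in Hy.
  now rewrite Ropp_0, Rplus_0_r in Hy.
- apply (continuous_ext_loc _ (fun x => (exp (c * x) - 1) / x)).
  + assert (Hp : 0 < x) by lra. exists (mkposreal x Hp). intros y Hy.
    unfold expm1_quot. destruct Req_dec_T as [->|]; [|reflexivity]. exfalso.
    unfold ball in Hy; simpl in Hy; unfold AbsRing_ball, abs, minus, plus, opp in Hy; simpl in Hy.
    rewrite Rplus_0_l, Rabs_Ropp, Rabs_pos_eq in Hy by lra. lra.
  + apply (@ex_derive_continuous R_AbsRing R_NormedModule). auto_derive. exact H.
Qed.

Definition hgauss (k : nat) (a x : R) : R :=
  exp (- (PI * a * x ^ 2)) * hyp1F1_neg (2 * k + 1) (3 / 2) (2 * (PI * a) * x ^ 2).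

Lemma J_integrand_expm1 k a x : 0 < x ->
  J_integrand k a x = hgauss k a x * / expm1_quot (2 * PI) x.
Proof.
intros Hx. unfold J_integrand, hgauss, expm1_quot. destruct Req_dec_T as [|_]; [lra|].
assert (HP := PI_RGT_0). assert (1 < exp (2 * PI * x)) by (rewrite <- exp_0; apply exp_increasing; nra).
replace (- PI * a * x ^ 2) with (- (PI * a * x ^ 2)) by ring.
replace (2 * PI * a * x ^ 2) with (2 * (PI * a) * x ^ 2) by ring. field. lra.
Qed.

(** At 0 the integrand evaluates to 0 whereas its limit is 1/(2 pi), so it is not continuous there.
    Integrability is taken from a continuous function that agrees with it for x > 0. *)
Lemma ex_RInt_J_integrand k a b : 0 <= b -> ex_RInt (J_integrand k a) 0 b.
Proof.
intros Hb. assert (HP := PI_RGT_0).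
apply (ex_RInt_ext (fun x => hgauss k a x * / expm1_quot (2 * PI) x)).
- intros x. rewrite Rmin_left, Rmax_right by lra. intros Hx. symmetry. apply J_integrand_expm1. lra.
- apply ex_RInt_cont; [|exact Hb]. intros x Hx.
  apply (continuous_mult (hgauss k a) (fun x => / expm1_quot (2 * PI) x)).
  + apply (continuous_mult (fun x => exp (- (PI * a * x ^ 2)))); [continuous_auto | apply continuous_hyp1F1].
  + apply continuous_Rinv_comp; [apply continuous_expm1_quot; lra|].
    apply Rgt_not_eq, expm1_quot_pos; lra.
Qed.

Lemma is_RInt_inf_exp c : 0 < c -> is_RInt_inf (fun x => exp (- (c * x))) 0 (/ c).
Proof.
intros Hc.
replace (/ c) with (- / c * 0 - - / c * exp (- (c * 0))) by (replace (- (c * 0)) with 0 by ring; rewrite exp_0; ring).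
apply (is_RInt_inf_derive _ (fun x => - / c * exp (- (c * x)))).
- intros x _. auto_derive; [exact I | field; lra].
- intros x _. continuous_auto.
- apply (is_lim_scal_l _ (- / c) p_infty 0). now apply is_lim_exp_neg_lin.
Qed.

Lemma geometric_remainder y N : 0 < y < 1 ->
  / (/ y - 1) = sum_f_R0 (fun n => y ^ S n) N + y ^ S N * / (/ y - 1).
Proof.
intros Hy. induction N as [|N IH].
- simpl. field. lra.
- rewrite tech5, IH at 1. simpl. field. lra.
Qed.

(** With y = exp(-2 pi x), the error after N + 1 terms is exactly y^(N+1) times the integrand. The
    Gaussian factor is bounded by [K] and x/(exp(2 pi x) - 1) by 1/(2 pi), so the error integrates
    to at most K/(2 pi)^2/(N + 1). *)
Lemma is_RInt_inf_J_integrand k a (U : nat -> R) : 0 < a ->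
  (forall n, is_RInt_inf (fun x => x * hgauss k a x * exp (- (2 * PI * (INR n + 1) * x))) 0 (U n)) ->
  exists l : R, is_lim_seq (sum_f_R0 U) l /\ is_RInt_inf (J_integrand k a) 0 l.
Proof.
intros Ha HU. assert (HP := PI_RGT_0).
destruct (hyp1F1_gauss_bound (2 * k + 1) (PI * a)) as [K HK]; [nra|].
set (b := fun n => 2 * PI * (INR n + 1)).
assert (Hb : forall n, 0 < b n) by (intros n; unfold b; generalize (pos_INR n); nra).
assert (HK0 : 0 <= K) by (eapply Rle_trans; [apply Rabs_pos | apply (HK 0)]).
apply (is_RInt_inf_approx _ 0
  (fun N x => sum_f_R0 (fun n => x * hgauss k a x * exp (- (b n * x))) N)
  (fun N x => K / (2 * PI) * exp (- (b N * x))) _ (fun N => K / (2 * PI) * / b N)).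
- intros X HX. now apply ex_RInt_J_integrand.
- intros N. apply (is_RInt_inf_sum (fun n x => x * hgauss k a x * exp (- (b n * x)))).
  intros j _. apply HU.
- intros N. apply is_RInt_inf_scal. now apply is_RInt_inf_exp.
- intros N x Hx.
  set (y := exp (- (2 * PI * x))).
  assert (Hy : 0 < y < 1).
  { split; [apply exp_pos|]. unfold y. rewrite <- exp_0. apply exp_increasing. nra. }
  assert (Hyb : forall n, exp (- (b n * x)) = y ^ S n).
  { intros n. unfold y. rewrite exp_pow, S_INR. f_equal. unfold b. ring. }
  assert (Hiy : / y = exp (2 * PI * x)) by (unfold y; rewrite exp_Ropp, Rinv_inv; reflexivity).
  assert (HQ : / expm1_quot (2 * PI) x = x * / (/ y - 1)).
  { unfold expm1_quot. destruct Req_dec_T as [|_]; [lra|]. rewrite <- Hiy.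
    assert (1 < / y) by (rewrite <- Rinv_1; apply Rinv_lt_contravar; lra).
    field. split; [|lra]. intros E. assert (y * / y = 1) by (field; lra). nra. }
  rewrite J_integrand_expm1 by exact Hx.
  replace (hgauss k a x * / expm1_quot (2 * PI) x - sum_f_R0 (fun n => x * hgauss k a x * exp (- (b n * x))) N)
    with (hgauss k a x * (y ^ S N * / expm1_quot (2 * PI) x)).
  2:{ rewrite HQ.
      rewrite (sum_eq (fun n => x * hgauss k a x * exp (- (b n * x))) (fun n => y ^ S n * (x * hgauss k a x)))
        by (intros n _; rewrite Hyb; ring).
      rewrite <- scal_sum. assert (G := geometric_remainder y N Hy). revert G.
      generalize (sum_f_R0 (fun n => y ^ S n) N), (/ (/ y - 1)). intros S Q G.
      replace S with (Q - y ^ Datatypes.S N * Q) by lra. ring. }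
  rewrite Rabs_mult, Hyb.
  assert (Hq : 0 < / expm1_quot (2 * PI) x <= / (2 * PI)).
  { split; [apply Rinv_0_lt_compat, expm1_quot_pos; lra|].
    apply Rinv_le_contravar; [lra|]. unfold expm1_quot. destruct Req_dec_T as [|_]; [lra|].
    apply Rmult_le_reg_r with x; [exact Hx|]. replace ((exp (2 * PI * x) - 1) / x * x) with (exp (2 * PI * x) - 1) by (field; lra).
    generalize (exp_ineq1_le (2 * PI * x)). lra. }
  assert (HyN : 0 < y ^ S N) by (apply pow_lt; lra).
  rewrite (Rabs_pos_eq (y ^ S N * _)) by (apply Rmult_le_pos; lra).
  apply Rle_trans with (K * (y ^ S N * / (2 * PI))).
  + apply Rmult_le_compat; [apply Rabs_pos | apply Rmult_le_pos; lra | apply HK | ].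
    apply Rmult_le_compat_l; lra.
  + unfold Rdiv. apply Req_le. ring.
- replace (Finite 0) with (Rbar_mult (K / (2 * PI)) 0) by (simpl; f_equal; ring).
  apply (is_lim_seq_scal_l (fun N => / b N)).
  replace (Finite 0) with (Rbar_inv p_infty) by reflexivity.
  apply is_lim_seq_inv; [|discriminate].
  apply (is_lim_seq_le_p_loc INR); [|apply is_lim_seq_INR].
  exists 0%nat. intros n _. unfold b. generalize (pos_INR n) PI2_3_2. nra.
Qed.

(** Under inversion the powers of t combine to t^(m + 3/2) t^(-m) t^(-2) = t^(-1/2), the source of
    1/sqrt t. On (1,oo) the odd power (1 - t)^m gives the minus sign. *)
Lemma laplace_kernel_fold c m u : 0 < c -> Nat.Odd m -> is_RInt_inf (laplace_kernel c m) 0 u ->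
  is_RInt_inf (fun t => (exp (- (c * / t)) / sqrt t - exp (- (c * t))) * beta_kernel m t) 1 u.
Proof.
intros Hc [k Hk] Hu.
assert (Hs : (-1) ^ m = -1) by (rewrite Hk, pow_add, pow_1_even; ring).
assert (Hcont : forall x, 0 <= x <= 1 -> continuous (laplace_kernel c m) x).
{ intros x Hx. unfold laplace_kernel.
  assert (0 < (1 + x) ^ m) by (apply pow_lt; lra).
  assert (0 < sqrt (1 + x)) by (apply sqrt_lt_R0; lra).
  apply (@ex_derive_continuous R_AbsRing R_NormedModule). auto_derive.
  repeat split; try lra. simpl. apply Rgt_not_eq. repeat apply Rmult_lt_0_compat; lra. }
assert (H1 := is_RInt_inf_from _ 0 1 u Rle_0_1 Hu).
assert (H2 := is_RInt_inf_inversion _ Hcont).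
replace u with (RInt (laplace_kernel c m) 0 1 + (u - RInt (laplace_kernel c m) 0 1)) by ring.
eapply is_RInt_inf_ext; [|exact (is_RInt_inf_plus _ _ _ _ _ H2 H1)].
intros t Ht. simpl. unfold laplace_kernel, beta_kernel.
destruct (sqrt_facts t) as [Hs1 [_ [Hr Hrr]]]; [lra|].
assert (Hp : 0 < (1 + t) ^ m) by (apply pow_lt; lra).
assert (Hq : 0 < t ^ m) by (apply pow_lt; lra).
replace (1 + / t) with ((1 + t) * / t) by (field; lra).
replace (1 - / t) with ((t - 1) * / t) by (field; lra).
replace (1 - t) with (-1 * (t - 1)) by ring.
rewrite sqrt_mult by (try apply Rlt_le, Rinv_0_lt_compat; lra).
rewrite sqrt_inv, !Rpow_mult_distr, !pow_inv, Hs. simpl pow.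
transitivity (exp (- (c * / t)) * ((t - 1) ^ m / ((1 + t) * (1 + t) ^ m * sqrt (1 + t))) * (sqrt t / t)
  - exp (- (c * t)) * ((t - 1) ^ m / ((1 + t) * (1 + t) ^ m * sqrt (1 + t)))).
- field. lra.
- replace (sqrt t / t) with (/ sqrt t); [field; lra|].
  revert Hr Hrr. generalize (sqrt t). intros r Hr Hrr. rewrite Hrr. field. lra.
Qed.

(** For y = w^4 this is exp(-y) <= y^(-3/4). Applied to exp(-c/t) with c of order n^2, an exponent
    above 1/2 makes the sum over n converge and one below 1 keeps the integral over t finite; 3/4
    lies midway and involves only fourth roots. *)
Lemma exp_neg_pow4_le w : 0 < w -> exp (- w ^ 4) <= / w ^ 3.
Proof.
intros Hw. rewrite exp_Ropp. apply Rinv_le_contravar; [now apply pow_lt|].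
apply Rle_trans with (1 + w ^ 4); [|apply exp_ineq1_le].
destruct (Rle_dec w 1) as [H|H].
- assert (w ^ 3 <= 1 ^ 3) by (apply pow_incr; lra). assert (0 <= w ^ 4) by (apply pow_le; lra).
  rewrite pow1 in *. lra.
- assert (0 <= w ^ 3 * (w - 1)) by (apply Rmult_le_pos; [apply pow_le; lra | lra]).
  simpl in *. lra.
Qed.

Lemma beta_kernel_bound m t : 1 <= t -> 0 <= beta_kernel m t <= / sqrt t ^ 3.
Proof.
intros Ht. destruct (sqrt_facts t) as [Hs1 [Hs2 [Hr Hrr]]]; [lra|]. unfold beta_kernel.
assert (Hp : 0 < (1 + t) ^ m) by (apply pow_lt; lra).
assert (0 <= (t - 1) ^ m) by (apply pow_le; lra).
assert ((t - 1) ^ m <= (1 + t) ^ m) by (apply pow_incr; lra).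
assert (Hrs : sqrt t <= sqrt (1 + t)) by (apply sqrt_le_1; lra).
assert (Hr3 : 0 < sqrt t ^ 3) by now apply pow_lt.
assert (H3 : sqrt t ^ 3 <= (1 + t) * sqrt (1 + t)).
{ rewrite Hs2 at 1. replace (sqrt (1 + t) ^ 2 * sqrt (1 + t)) with (sqrt (1 + t) ^ 3) by ring.
  apply pow_incr. lra. }
split.
- apply Rdiv_le_0_compat; [assumption|]. simpl. repeat apply Rmult_lt_0_compat; lra.
- replace ((t - 1) ^ m / ((1 + t) ^ S m * sqrt (1 + t)))
    with ((t - 1) ^ m / (1 + t) ^ m * / ((1 + t) * sqrt (1 + t))) by (simpl; field; lra).
  apply Rle_trans with (1 * / ((1 + t) * sqrt (1 + t))).
  + apply Rmult_le_compat_r.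
    * apply Rlt_le, Rinv_0_lt_compat. lra.
    * apply Rmult_le_reg_r with ((1 + t) ^ m); [exact Hp|].
      unfold Rdiv. rewrite Rmult_assoc, Rinv_l by lra. lra.
  + rewrite Rmult_1_l. apply Rinv_le_contravar; lra.
Qed.

Lemma is_RInt_inf_five_quarters : is_RInt_inf (fun t => / (t * sqrt (sqrt t))) 1 4.
Proof.
assert (HF : forall t, 1 <= t -> 0 < sqrt (sqrt t) /\ 0 < sqrt t /\ sqrt t = sqrt (sqrt t) ^ 2 /\ t = sqrt t ^ 2).
{ intros t Ht. assert (0 < sqrt t) by (apply sqrt_lt_R0; lra).
  repeat split; try assumption; [now apply sqrt_lt_R0 | |]; simpl; rewrite Rmult_1_r, sqrt_sqrt; lra. }
replace 4 with (-4 * 0 - -4 * / sqrt (sqrt 1)) by (rewrite !sqrt_1; field).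
apply (is_RInt_inf_derive _ (fun t => -4 * / sqrt (sqrt t))).
- intros t Ht. destruct (HF t Ht) as [H1 [H2 [H3 H4]]]. auto_derive.
  + repeat split; lra.
  + revert H1 H2 H3 H4. generalize (sqrt (sqrt t)). intros r. generalize (sqrt t). intros z H1 H2 H3 H4.
    rewrite H4, H3. field. lra.
- intros t Ht. destruct (HF t Ht) as [H1 [H2 _]].
  apply (@ex_derive_continuous R_AbsRing R_NormedModule). auto_derive.
  repeat split; try lra. apply Rgt_not_eq, Rmult_lt_0_compat; lra.
- apply (is_lim_scal_l (fun t => / sqrt (sqrt t)) (-4) p_infty 0).
  replace (Finite 0) with (Rbar_inv p_infty) by reflexivity.
  apply is_lim_inv; [|discriminate]. apply (is_lim_sqrt_p sqrt). apply filterlim_sqrt_p.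
Qed.

Definition folded_kernel (c : R) (m : nat) (t : R) : R :=
  (exp (- (c * / t)) / sqrt t - exp (- (c * t))) * beta_kernel m t.

(** Put t = r^4 and use the previous estimate at w/r and at w r. With the factor r^(-6) from
    [beta_kernel_bound], the two parts are at most w^(-3) r^(-5) and w^(-3) r^(-9), and r >= 1. *)
Lemma folded_kernel_kernel_bound w m t : 0 < w -> 1 <= t ->
  Rabs (folded_kernel (w ^ 4) m t) <= 2 / w ^ 3 * / (t * sqrt (sqrt t)).
Proof.
intros Hw Ht. destruct (beta_kernel_bound m t Ht) as [Q1 Q2].
assert (Hz : 1 <= sqrt t) by (rewrite <- sqrt_1; apply sqrt_le_1; lra).
assert (Hr : 1 <= sqrt (sqrt t)) by (rewrite <- sqrt_1; apply sqrt_le_1; lra).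
assert (H3 : sqrt t = sqrt (sqrt t) ^ 2) by (simpl; rewrite Rmult_1_r, sqrt_sqrt; lra).
assert (H4 : t = sqrt t ^ 2) by (simpl; rewrite Rmult_1_r, sqrt_sqrt; lra).
unfold folded_kernel. generalize (beta_kernel m t) Q1 Q2. clear Q1 Q2. intros q.
revert Hz Hr H3 H4. generalize (sqrt (sqrt t)). intros r. generalize (sqrt t). intros z Hz Hr H3 H4 Q1 Q2.
rewrite H3 in H4 |- *. rewrite H3 in Q2. subst t. clear H3 Hz Ht z.
assert (E1 := exp_neg_pow4_le (w / r) ltac:(apply Rdiv_lt_0_compat; lra)).
assert (E2 := exp_neg_pow4_le (w * r) ltac:(nra)).
replace (- (w / r) ^ 4) with (- (w ^ 4 * / (r ^ 2) ^ 2)) in E1 by (field; lra).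
replace (- (w * r) ^ 4) with (- (w ^ 4 * (r ^ 2) ^ 2)) in E2 by ring.
assert (P1 := exp_pos (- (w ^ 4 * / (r ^ 2) ^ 2))). assert (P2 := exp_pos (- (w ^ 4 * (r ^ 2) ^ 2))).
revert E1 E2 P1 P2. generalize (exp (- (w ^ 4 * / (r ^ 2) ^ 2))), (exp (- (w ^ 4 * (r ^ 2) ^ 2))).
intros e1 e2 E1 E2 P1 P2.
assert (Hr2 : 0 < / r ^ 2) by (apply Rinv_0_lt_compat, pow_lt; lra).
assert (Hw3 : 0 < w ^ 3) by now apply pow_lt.
rewrite Rabs_mult, (Rabs_pos_eq q) by exact Q1.
apply Rle_trans with ((/ (w / r) ^ 3 / r ^ 2 + / (w * r) ^ 3) * / (r ^ 2) ^ 3).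
- apply Rmult_le_compat; [apply Rabs_pos | exact Q1 | | exact Q2].
  assert (A : 0 <= e1 / r ^ 2 <= / (w / r) ^ 3 / r ^ 2).
  { split; [apply Rmult_le_pos; lra | apply Rmult_le_compat_r; lra]. }
  apply Rabs_le. lra.
- assert (Hr4 : 0 < / r ^ 4 <= 1).
  { split; [apply Rinv_0_lt_compat, pow_lt; lra|]. rewrite <- Rinv_1.
    apply Rinv_le_contravar; [lra|]. rewrite <- (pow1 4). apply pow_incr. lra. }
  assert (Hr5 : 0 < / (w ^ 3 * r ^ 5)) by (apply Rinv_0_lt_compat, Rmult_lt_0_compat; [exact Hw3 | apply pow_lt; lra]).
  replace ((/ (w / r) ^ 3 / r ^ 2 + / (w * r) ^ 3) * / (r ^ 2) ^ 3)
    with (/ (w ^ 3 * r ^ 5) * (1 + / r ^ 4)) by (field; lra).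
  replace (2 / w ^ 3 * / ((r ^ 2) ^ 2 * r)) with (/ (w ^ 3 * r ^ 5) * 2) by (field; lra).
  apply Rmult_le_compat_l; lra.
Qed.

Lemma theta_sum_scaled a y : Series (fun n => exp (- (PI * (INR n + 1) ^ 2 / a * y))) = theta_sum (y / a).
Proof. apply Series_ext. intros n. do 2 f_equal. unfold Rdiv. ring. Qed.

Lemma half_line_identity a k : 0 < a ->
  exists E : R,
    is_RInt_inf (eps_integrand k a) 1 E /\
    is_RInt_inf (J_integrand k a) 0 (- T_val k a + / (4 * PI * a) * E).
Proof.
intros Ha. assert (HP := PI_RGT_0). set (m := (2 * k + 1)%nat).
set (c := fun n => PI * (INR n + 1) ^ 2 / a).
assert (Hn1 : forall n, 0 < INR n + 1) by (intros n; generalize (pos_INR n); lra).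
assert (Hc : forall n, 0 < c n).
{ intros n. apply Rdiv_lt_0_compat; [|exact Ha]. specialize (Hn1 n). apply Rmult_lt_0_compat; [lra | now apply pow_lt]. }
assert (Hpa : 0 < PI * a) by nra.
set (U := fun n => RInt_gen (laplace_kernel (c n) m) (at_point 0) (Rbar_locally p_infty)).
assert (HL : forall n, exists u, u = U n /\ is_RInt_inf (laplace_kernel (c n) m) 0 u /\
  is_RInt_inf (fun x => x * hgauss k a x * exp (- (2 * PI * (INR n + 1) * x))) 0 (/ (4 * (PI * a)) * u)).
{ intros n. destruct (laplace_hyp1F1 (PI * a) (2 * PI * (INR n + 1)) m Hpa) as [u [Hu Hu']].
  - specialize (Hn1 n). nra.
  - replace ((2 * PI * (INR n + 1)) ^ 2 / (4 * (PI * a))) with (c n) in Hu by (unfold c; field; lra).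
    exists u. split; [symmetry; exact (is_RInt_inf_RInt_gen _ _ _ Hu)|]. split; [exact Hu|].
    replace (/ (4 * (PI * a)) * u) with (u / (4 * (PI * a))) by (unfold Rdiv; ring).
    eapply is_RInt_inf_ext; [|exact Hu']. intros x _. unfold hgauss, m. ring. }
assert (HU1 : forall n, is_RInt_inf (laplace_kernel (c n) m) 0 (U n)).
{ intros n. destruct (HL n) as [u [<- [Hu _]]]. exact Hu. }
assert (HU2 : forall n, is_RInt_inf (fun x => x * hgauss k a x * exp (- (2 * PI * (INR n + 1) * x))) 0
   (/ (4 * (PI * a)) * U n)).
{ intros n. destruct (HL n) as [u [<- [_ Hu]]]. exact Hu. }
clear HL.
destruct (is_RInt_inf_J_integrand k a _ Ha HU2) as [lJ [LJ IJ]].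
(* The fourth root of pi/a, so that [c n] is the fourth power of w sqrt(n + 1) and the majorant
   splits off (n + 1)^(-3/2). *)
set (w := sqrt (sqrt (PI / a))).
assert (Hw : 0 < w) by (apply sqrt_lt_R0, sqrt_lt_R0, Rdiv_lt_0_compat; lra).
assert (Hw4 : w ^ 4 = PI / a).
{ replace (w ^ 4) with ((w * w) * (w * w)) by ring. unfold w.
  rewrite !sqrt_sqrt; try apply sqrt_pos; [reflexivity|]. apply Rlt_le, Rdiv_lt_0_compat; lra. }
destruct (is_RInt_inf_series (fun n t => folded_kernel (c n) m t) (fun t => / (t * sqrt (sqrt t)))
  (fun n => 2 / w ^ 3 * / ((INR n + 1) * sqrt (INR n + 1))) U 1 4 1) as [lF [LF IF]].
- intros n. apply laplace_kernel_fold; [apply Hc | exists k; unfold m; lia | apply HU1].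
- intros n t Ht. specialize (Hn1 n).
  assert (Hs : 0 < sqrt (INR n + 1)) by now apply sqrt_lt_R0.
  assert (Hss : INR n + 1 = sqrt (INR n + 1) ^ 2) by (simpl; rewrite Rmult_1_r, sqrt_sqrt; lra).
  assert (B := folded_kernel_kernel_bound (w * sqrt (INR n + 1)) m t ltac:(nra) Ht).
  replace ((w * sqrt (INR n + 1)) ^ 4) with (c n) in B.
  2:{ unfold c. rewrite Rpow_mult_distr, Hw4. rewrite Hss at 1. field. lra. }
  eapply Rle_trans; [exact B|]. apply Req_le. f_equal.
  revert Hs Hss. generalize (sqrt (INR n + 1)). intros s Hs Hss. rewrite Hss. field. lra.
- intros t Ht. assert (1 <= sqrt (sqrt t)).
  { rewrite <- sqrt_1. apply sqrt_le_1; [lra | apply sqrt_pos |]. rewrite <- sqrt_1. apply sqrt_le_1; lra. }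
  split; [apply Rlt_le, Rinv_0_lt_compat; nra|].
  rewrite <- Rinv_1. apply Rinv_le_contravar; nra.
- apply (ex_series_scal (2 / w ^ 3) (fun n => / ((INR n + 1) * sqrt (INR n + 1)))), ex_series_three_halves.
- exact is_RInt_inf_five_quarters.
- assert (El : lJ = / (4 * (PI * a)) * lF).
  { assert (L : is_lim_seq (sum_f_R0 (fun n => / (4 * (PI * a)) * U n)) (/ (4 * (PI * a)) * lF)).
    { apply (is_lim_seq_ext (fun N => / (4 * (PI * a)) * sum_f_R0 U N)).
      - intros N. rewrite scal_sum. apply sum_eq. intros; ring.
      - apply (is_lim_seq_scal_l (sum_f_R0 U) _ lF), LF. }
    apply is_lim_seq_unique in L. rewrite (is_lim_seq_unique _ _ LJ) in L. now injection L. }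
  subst lJ.
  assert (IA := is_RInt_inf_beta_kernel m). assert (IB := is_RInt_inf_beta_kernel_sqrt m).
  assert (Hm : (-1) ^ m = -1) by (unfold m; rewrite pow_add, pow_1_even; ring).
  rewrite Hm in IB.
  set (A := sqrt 2 * wint m) in *. set (B := 2 * -1 * pint m 1 - _) in IB.
  (* Since m is odd, 2F1 is -[pint m 1]. Hence 4 pi a T = (1 - sqrt a)/2 A + 2F1 = B/2 - (sqrt a/2)
     A. *)
  assert (HAB : B = 2 * hyp2F1_neg m 1 (3 / 2) 2 + A).
  { unfold A, B. rewrite hyp2F1_pint, Hm.
    assert (H2 : 0 < sqrt 2) by (apply sqrt_lt_R0; lra).
    replace (sqrt 2 * wint m) with (2 * (/ sqrt 2 * wint m)); [ring|].
    rewrite <- (sqrt_sqrt 2) at 1 by lra. field. lra. }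
  (* The theta transformation gives psi(1/t)/sqrt t = sqrt a phi(t) + sqrt a/2 - 1/(2 sqrt t). The
     last two terms, integrated against [beta_kernel m], contribute (sqrt a/2) A - B/2 to [lF] and
     are removed here. *)
  exists (lF + (- (sqrt a / 2) * A + / 2 * B)). split.
  + eapply is_RInt_inf_ext;
      [|exact (is_RInt_inf_plus _ _ _ _ _ IF (is_RInt_inf_plus _ _ _ _ _
          (is_RInt_inf_scal _ _ (- (sqrt a / 2)) _ IA) (is_RInt_inf_scal _ _ (/ 2) _ IB)))].
    intros t Ht. simpl.
    assert (Hsa : 0 < sqrt a) by now apply sqrt_lt_R0.
    assert (Hst : 0 < sqrt t) by (apply sqrt_lt_R0; lra).
    assert (S1 : Series (fun n => folded_kernel (c n) m t) = (theta_sum (/ (a * t)) / sqrt t - theta_sum (t / a)) * beta_kernel m t).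
    { unfold folded_kernel. rewrite Series_scal_r. f_equal.
      rewrite Series_minus.
      - f_equal.
        + transitivity (Series (fun n => exp (- (c n * / t))) * / sqrt t); [apply Series_scal_r|].
          apply (f_equal (fun z => z * / sqrt t)).
          replace (/ (a * t)) with (/ t / a) by (field; lra). apply theta_sum_scaled.
        + apply theta_sum_scaled.
      - apply (ex_series_scal_r (/ sqrt t) (fun n => exp (- (c n * / t)))).
        apply (ex_series_ext (fun l => exp (- (PI * (INR l + 1) ^ 2 * (/ t / a))))).
        + intros n. f_equal. unfold c, Rdiv. ring.
        + apply ex_series_theta. apply Rdiv_lt_0_compat; [apply Rinv_0_lt_compat; lra | lra].
      - apply (ex_series_ext (fun l => exp (- (PI * (INR l + 1) ^ 2 * (t / a))))).
        + intros n. f_equal. unfold c, Rdiv. ring.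
        + apply ex_series_theta. apply Rdiv_lt_0_compat; lra. }
    rewrite S1. unfold eps_integrand.
    replace (phi_theta a t) with (theta_sum (a * t)).
    2:{ apply Series_ext. intros n. f_equal. ring. }
    replace (psi_theta a t) with (theta_sum (t / a)).
    2:{ apply Series_ext. intros n. f_equal. unfold Rdiv. ring. }
    replace ((sqrt a * theta_sum (a * t) - theta_sum (t / a)) * (t - 1) ^ (2 * k + 1) /
        Rpower (1 + t) (2 * INR k + 5 / 2)) with
      ((sqrt a * theta_sum (a * t) - theta_sum (t / a)) * beta_kernel m t).
    2:{ unfold beta_kernel. fold m.
        replace (Rpower (1 + t) (2 * INR k + 5 / 2)) with ((1 + t) ^ S m * sqrt (1 + t)); [unfold Rdiv; ring|].
        rewrite <- Rpower_pow, <- Rpower_sqrt, <- Rpower_plus by lra. f_equal.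
        unfold m. rewrite S_INR, plus_INR, mult_INR. simpl. field. }
    assert (J := theta_jacobi (a * t) ltac:(nra)). rewrite sqrt_mult in J by lra.
    replace (theta_sum (/ (a * t))) with ((sqrt a * sqrt t * (1 + 2 * theta_sum (a * t)) - 1) / 2).
    * field. lra.
    * rewrite J. field. lra.
  + replace (- T_val k a + _) with (/ (4 * (PI * a)) * lF); [exact IJ|].
    unfold T_val. rewrite (Rmult_assoc ((1 - sqrt a) / 2)), Gamma_ratio. fold m. fold A.
    rewrite HAB. field. lra.
Qed.

(* Both improper integrals converge, and
   J_{2k+1}(a) = - T_{2k+1}(a) + eps_{2k+1}(a),
   where eps_{2k+1}(a) = (1/(4 pi a)) * E and E = int_1^oo eps_integrand. *)
Theorem theorem2 (a : R) (k : nat) (ha : 0 < a) :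
  exists E : R,
    is_RInt_gen (eps_integrand k a) (at_point 1) (Rbar_locally p_infty) E /\
    is_RInt_gen (J_integrand k a) (at_point 0) (Rbar_locally p_infty)
      (- T_val k a + / (4 * PI * a) * E).
Proof.
destruct (half_line_identity a k ha) as [E [H1 H2]].
exists E. split; apply is_RInt_inf_gen; assumption.
Qed.
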